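(* For any fixed edge-probability $p \in (0,1)$ there are constants $c, C > 0$ such that, with high probability, the Prague dimension of the binomial random graph $G_{n,p}$ satisfies $$ c\,\frac{n}{\log n} \;\le\; \dim_{\mathrm{P}}(G_{n,p}) \;\le\; C\,\frac{n}{\log n}. $$
   Context: The binomial random graph $G_{n,p}$ has vertex set $[n]=\{1,\dots,n\}$, and each of the $\binom n2$ possible edges is included independently with probability $p$. ''With high probability'' means with probability tending to $1$ as $n\to\infty$. The Prague dimension $\dim_{\mathrm P}(G)$ of a graph $G$ (also called product dimension) is the minimum number $d$ such that $G$ is isomorphic to an induced subgraph of the product of $d$ complete graphs. Here the product is the categorical (direct) product: vertices are $d$-tuples, and two $d$-tuples are adjacent iff they differ in every coordinate. Equivalently, $\dim_{\mathrm P}(G)$ is the minimum number of subgraphs of the complement $\overline G$ of $G$ such that (i) each subgraph is a vertex-disjoint union of cliques, and (ii) each edge of $\overline G$ is contained in at least one of the subgraphs, but not in all of them. *)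

(* Defs.v *)
From HB Require Import structures.
From mathcomp Require Import all_boot all_order all_algebra.
From mathcomp Require Import all_classical all_reals all_analysis.

Set Implicit Arguments.
Unset Strict Implicit.
Unset Printing Implicit Defensive.

Import Order.TTheory GRing.Theory Num.Theory.
Import numFieldNormedType.Exports.

Local Open Scope ring_scope.

Record graph (T : finType) := Graph {
  edges :> {set {set T}};
  _ : [forall e in edges, #|e| == 2%N] }.

HB.instance Definition _ (T : finType) := [isSub for @edges T].
HB.instance Definition _ (T : finType) := [Finite of graph T by <:].

Definition adj (T : finType) (G : graph T) : rel T :=
  fun x y => [set x; y]%SET \in edges G.

Definition complete_rel (T : eqType) : rel T := fun x y => x != y.

(* The empty product is a single vertex with a loop, hence only a relation. *)
Definition direct_product (d : nat) (V : 'I_d -> finType)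
    (e : forall i, rel (V i)) : rel {dffun forall i : 'I_d, V i} :=
  fun x y => [forall i, e i (x i) (y i)].

Definition induced_embedding (T U : Type) (e : rel T) (e' : rel U)
    (f : T -> U) : Prop :=
  injective f /\ forall x y, e x y = e' (f x) (f y).

Definition embeds_in_product (T : finType) (G : graph T) (d : nat) : Prop :=
  exists (m : 'I_d -> nat)
         (f : T -> {dffun forall i : 'I_d, 'I_(m i)}),
    induced_embedding (adj G)
      (direct_product (fun i => @complete_rel 'I_(m i))) f.

Lemma adj_sym (T : finType) (G : graph T) : symmetric (adj G).
Proof. by move=> x y; rewrite /adj finset.setUC. Qed.

Lemma adj_irrefl (T : finType) (G : graph T) : irreflexive (adj G).
Proof.
case: G => E /= HE x; apply/negP; rewrite /adj /= => xxE.
by move/forall_inP/(_ _ xxE): HE; rewrite finset.setUid cards1.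
Qed.

(* One coordinate for each pair (u, v): it is injective except that it
   identifies v with u when they are not adjacent. *)
Lemma embeds_in_some_product (T : finType) (G : graph T) :
  exists d, `[< embeds_in_product G d >].
Proof.
pose glue (w : T * T) x := if (x == w.2) && ~~ adj G w.1 w.2 then w.1 else x.
exists #|{: T * T}|; apply/asboolP; exists (fun=> #|T|).
exists (fun x => [ffun i => enum_rank (glue (enum_val i) x)]).
have glue_id x y : glue (x, x) y = y.
  by rewrite /glue /=; case: eqP => [->|//]; case: ifP.
split.
  move=> x y /ffunP/(_ (enum_rank (x, x))); rewrite !ffunE enum_rankK.
  by move/enum_rank_inj; rewrite !glue_id.
move=> x y; apply/idP/forallP => [xy i|xy].
  rewrite /complete_rel !ffunE (inj_eq enum_rank_inj).
  case: (enum_val i) => u v; rewrite /glue /=.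
  have x_y : x != y by apply: contraTneq xy => ->; rewrite adj_irrefl.
  have [xv|xv] := eqVneq x v; have [yv|yv] := eqVneq y v => //=.
  - by rewrite xv yv eqxx in x_y.
  - case: ifP => // /negP nuv; apply/eqP => uy; apply: nuv.
    by rewrite uy -xv adj_sym.
  - case: ifP => // /negP nuv; apply/eqP => xu; apply: nuv.
    by rewrite -xu -yv.
have := xy (enum_rank (x, y)).
rewrite /complete_rel !ffunE enum_rankK (inj_eq enum_rank_inj) /glue /= eqxx /=.
by case: (boolP (adj G x y)) => // _; case: ifP; rewrite eqxx.
Qed.

Definition prague_dim (T : finType) (G : graph T) : nat :=
  ex_minn (embeds_in_some_product G).

Definition gnp_weight (R : realType) (n : nat) (p : R) (G : graph 'I_n) : R :=
  \prod_(e : {set 'I_n} | #|e| == 2%N) (if e \in edges G then p else 1 - p).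

Definition gnp_prob (R : realType) (n : nat) (p : R) (A : pred (graph 'I_n))
    : R :=
  \sum_(G : graph 'I_n | A G) gnp_weight p G.

Lemma gnp_prob_total (R : realType) (n : nat) (p : R) :
  gnp_prob p (fun _ : graph 'I_n => true) = 1.
Proof.
pose P (e : {set 'I_n}) := #|e| == 2%N.
pose a e := if P e then p else 0; pose b e := if P e then 1 - p else 1.
have -> : 1 = \prod_(e : {set 'I_n}) (a e + b e).
  rewrite big1// => e _; rewrite /a /b.
  by case: ifP => _; rewrite ?add0r// addrC subrK.
rewrite bigA_distr (bigID (fun E : {set {set 'I_n}} => [forall e in E, P e])) /=.
rewrite [X in _ + X]big1 ?addr0; last first.
  move=> E /forall_inPn[e eE /negbTE Pe].
  by rewrite (bigD1 e)//= eE /a Pe mul0r.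
rewrite (reindex_omap (@edges _) insub) /=; last first.
  by move=> E HE; case: insubP => [u _ /= ->//|]; rewrite HE.
rewrite /gnp_prob; apply: eq_big => [G|G _].
  by rewrite valK eqxx andbT; case: G => E HE; rewrite HE.
rewrite /gnp_weight big_mkcond; apply: eq_bigr => e _.
have Pedge : e \in edges G -> P e by case: G => E /= /forall_inP; apply.
rewrite /a /b.
by case: (boolP (e \in edges G)) => [/Pedge Pe|_]; rewrite ?Pe -?/(P e) ?Pe.
Qed.

(* Main.v *)
Require Import Defs.
From mathcomp Require Import all_boot all_order all_algebra.
From mathcomp Require Import all_classical all_reals all_analysis.
From mathcomp Require Import zify ring lra.
From mathcomp Require Import fintype finset.

Set Implicit Arguments.
Unset Strict Implicit.
Unset Printing Implicit Defensive.

Import Order.TTheory GRing.Theory Num.Theory.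
Import numFieldNormedType.Exports.

(** Write H for the complement of the random graph G, a random graph of constant
density q = 1 - p.  A coordinate of an embedding of G into a product of complete
graphs partitions the vertices into cliques of H, and two distinct vertices are
adjacent in H iff they share a clique in some coordinate.  So the dimension is,
up to the one coordinate that separates all vertices, the least number of
packings (families of vertex-disjoint cliques of H) that cover the edges of H.

Lower bound ([degree_le_prague_dim]).  With high probability cliques of H
have O(log n) vertices, so one packing covers O(log n) of the edges at a given
vertex, while some vertex has linear degree in H.

Upper bound ([clique_packing_cover]).  It uses only one property of H
([clique_rich]): every set of at least n^(1/4) vertices contains an H-clique
with l vertices, where l is a small multiple of log n.  Let J be the graph of
the edges still to be covered, with maximum degree at most 4 e.

- In one round, take a maximal packing by blocks Q1 u Q2, where Q1 and Q2 are
  H-cliques of size s, J is complete between them, and Q1 lies in the set D of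
  vertices of degree above 2 e.  Every vertex of a block loses s edges.  Dependent
  random choice ([dependent_random_choice]) shows that a large set of vertices of
  density delta towards the unused vertices contains Q1 with at least n^(1/4)
  common neighbours, hence a further block, as long as s is a small multiple of
  log n / log (1/delta).  By maximality a constant proportion of D is served, and
  nearly all of D if D is small ([serving_round]).
- O(log (n/e)) groups of O(e/s) rounds make D small ([shrink_heavy]), and one more
  group leaves only about n^(1/2) vertices of degree above 2 e ([sweep_heavy]).
  Set these aside in Z; the maximum degree has been halved at the cost of
  O(log (n/e) e/s) packings.
- With e of order n/2^i and s of order l/i, stage i costs O(i^2 2^(-i) n/l)
  packings: the sum over all stages is O(n/l) ([stages]).
- After about l/2 stages the maximum degree is below n/l^2.  Split the
  neighbourhood of each vertex z of Z into cliques of size at most l and add z to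
  each of them.  These stars and the uncovered edges meet few of one another, and
  a greedy colouring of them yields O(n/l) further packings ([finish_cover]).

Probability ([typical_prob]).  If every set U of at least C log n vertices contains
a vertex with a constant proportion of U as H-neighbours, then choosing such
vertices greedily finds cliques of logarithmic size ([clique_rich_dense]).  That
this holds for all U, and that H has no large clique, follows from the
union bound: the number of edges of H in U has an explicit moment generating
function, because the expectation of a product over pairs factorizes
([gnp_prob_moment]). *)

(** * Cliques, packings and uncovered edges *)

Section CliquePackings.
Variables (T : finType) (H : rel T).
Implicit Types (J : rel T) (K Q : {set T}) (P : {set {set T}}) (x y v : T).

Definition nbhd J v := [set y | J v y].

Definition clique K := [forall x in K, forall y in K, (x != y) ==> H x y].

Lemma cliqueP K :
  reflect {in K &, forall x y, x != y -> H x y} (clique K).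
Proof.
apply: (iffP forall_inP) => [h x y xK yK xy | h x xK].
  by move/forall_inP: (h x xK) => /(_ y yK); rewrite xy.
by apply/forall_inP => y yK; apply/implyP; apply: h.
Qed.

Lemma cliqueS K Q : Q \subset K -> clique K -> clique Q.
Proof.
move=> /subsetP QK /cliqueP h; apply/cliqueP => x y /QK xK /QK yK.
exact: h.
Qed.

Definition packing P := trivIset P && [forall K in P, clique K].

Definition together P x y := [exists K in P, (x \in K) && (y \in K)].

Lemma togetherC P x y : together P x y = together P y x.
Proof. by apply: eq_existsb => K; rewrite [(x \in K) && _]andbC. Qed.

Definition residual J P : rel T := fun x y => J x y && ~~ together P x y.

Lemma residual_sym J P : symmetric J -> symmetric (residual J P).
Proof. by move=> Js x y; rewrite /residual Js togetherC. Qed.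

Lemma residuals_sub J Ps : subrel (foldl residual J Ps) J.
Proof.
elim: Ps J => [|P Ps IH] J x y //= /IH; rewrite /residual.
by case/andP.
Qed.

Lemma residuals_sym J Ps : symmetric J -> symmetric (foldl residual J Ps).
Proof. by elim: Ps J => [|P Ps IH] J //= Js; apply/IH/residual_sym. Qed.

Lemma residualsE J Ps x y :
  foldl residual J Ps x y = J x y && ~~ has (fun P => together P x y) Ps.
Proof.
elim: Ps J => [|P Ps IH] J /=; first by rewrite andbT.
by rewrite IH /residual negb_or andbA.
Qed.

Lemma sub_nbhd J J' v : subrel J J' -> nbhd J v \subset nbhd J' v.
Proof. by move=> JJ'; apply/subsetP => y; rewrite !inE => /JJ'. Qed.

Lemma nbhd_residual J P v :
  #|nbhd (residual J P) v| + #|[set y | J v y && together P v y]| =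
  #|nbhd J v|.
Proof.
rewrite -(cardsID [set y | together P v y] (nbhd J v)) addnC.
congr (_ + _); apply: eq_card => y; rewrite !inE //.
by rewrite /residual andbC.
Qed.

End CliquePackings.

(** * Dependent random choice *)

Lemma leq_bin_exp n k : 'C(n, k) <= n ^ k.
Proof.
have h : n ^_ k <= n ^ k.
  elim: k => [|k IH]; first by rewrite ffactn0 expn0.
  by rewrite ffactnSr expnSr leq_mul // leq_subr.
by apply: leq_trans h; rewrite -bin_ffact leq_pmulr // fact_gt0.
Qed.

Section DependentRandomChoice.
Variables (T : finType) (J : rel T).
Implicit Types (B Q W : {set T}).

Definition common_nbhd B Q := [set y in B | [forall q in Q, J q y]].

(** Choose t vertices at random, and let A be the set of the vertices in W for which
all t of them are neighbours in B.  A vertex of W is in A with probability at least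
(e / #|T|)^t, whereas an s-set with fewer than M common neighbours in B is rarely
inside A, since all t choices must fall among these neighbours.  By the second
hypothesis, the size of A minus #|T| times the number of such s-sets inside A has
expectation greater than M; as A has at most #|T| elements, for some choice A is
large and contains none of them. *)
Lemma dependent_random_choice W B (s t M e : nat) : 0 < s ->
  {in W, forall w, e <= #|nbhd J w :&: B|} ->
  #|T| ^ s.+1 * M ^ t + M * #|T| ^ t < #|W| * e ^ t ->
  exists A : {set T}, [/\ A \subset W, M <= #|A| &
    forall Q, Q \subset A -> #|Q| = s -> M <= #|common_nbhd B Q|].
Proof.
move=> s_gt0 We hlt.
pose nb (f : {ffun 'I_t -> T}) w := [forall i, f i \in nbhd J w :&: B].
pose A (f : {ffun 'I_t -> T}) := [set w in W | nb f w].
pose bad Q := (#|Q| == s) && (#|common_nbhd B Q| < M).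
pose goodf f :=
  (M <= #|A f|) && [forall Q : {set T}, bad Q ==> ~~ (Q \subset A f)].
have [/existsP[f /andP[MA /forallP gf]]|/existsPn nogood] :=
    boolP [exists f, goodf f].
  exists (A f); split=> //; first by apply/subsetP => w; rewrite inE => /andP[].
  move=> Q QA Qs; rewrite leqNgt; apply/negP => QM.
  by have := gf Q; rewrite QA implybF /bad Qs eqxx QM.
suff: #|W| * e ^ t <= #|T| ^ s.+1 * M ^ t + M * #|T| ^ t by rewrite leqNgt hlt.
pose nbad f := \sum_(Q | bad Q) (Q \subset A f : nat).
have sumA : #|W| * e ^ t <= \sum_(f : {ffun 'I_t -> T}) #|A f|.
  have -> : \sum_f #|A f| = \sum_(w in W) \sum_f (nb f w : nat).
    rewrite exchange_big /=; apply: eq_bigr => f _.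
    rewrite -sum1_card; under eq_bigl do rewrite inE.
    by rewrite big_mkcondr; apply: eq_bigr => w _; case: (nb f w).
  rewrite -sum_nat_const; apply: leq_sum => w /We ew.
  have -> : \sum_f (nb f w : nat) = #|nbhd J w :&: B| ^ t.
    rewrite -[in RHS](card_ord t) -card_ffun_on -sum1_card [RHS]big_mkcond /=.
    apply: eq_bigr => f _.
    have -> : nb f w = (f \in ffun_on (mem (nbhd J w :&: B))).
      by apply/forallP/ffun_onP => h i; have := h i.
    by case: (_ \in _).
  by case: (posnP t) => [->|t0]; rewrite ?expn0 ?leq_exp2r.
have sumbad : \sum_f nbad f <= #|T| ^ s * M ^ t.
  rewrite /nbad exchange_big /=.
  apply: (@leq_trans (\sum_(Q | bad Q) M ^ t)).
    apply: leq_sum => Q /andP[/eqP Qs QM].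
    apply: (@leq_trans (#|common_nbhd B Q| ^ t)); last first.
      by case: (posnP t) => [->|t0]; rewrite ?expn0 ?leq_exp2r // ltnW.
    rewrite -[in leqRHS](card_ord t) -card_ffun_on -sum1_card.
    rewrite [leqRHS]big_mkcond /=; apply: leq_sum => f _.
    have [/subsetP QA|//] := boolP (Q \subset A f); rewrite ifT //.
    apply/ffun_onP => i.
    have qnb q : q \in Q -> f i \in nbhd J q :&: B.
      by move=> /QA; rewrite inE => /andP[_ /forallP]; apply.
    have /card_gt0P[q qQ] : 0 < #|Q| by rewrite Qs.
    rewrite !inE; have := qnb q qQ; rewrite !inE => /andP[_ ->] /=.
    by apply/forall_inP => r /qnb; rewrite !inE => /andP[].
  rewrite sum_nat_const leq_mul2r; apply/orP; right.
  apply: leq_trans (leq_bin_exp _ _); rewrite -card_draws.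
  by apply/subset_leq_card/subsetP => Q; rewrite unfold_in inE => /andP[].
apply: leq_trans sumA _.
(* Each f fails: either A f is small, or it contains a bad set and #|A f| <= #|T|. *)
apply: (@leq_trans (\sum_f (#|T| * nbad f + M))).
  apply: leq_sum => f _; have := nogood f; rewrite negb_and => /orP[].
    by rewrite -ltnNge => /ltnW h; apply: leq_trans (leq_addl _ _).
  case/forallPn => Q; rewrite negb_imply negbK => /andP[bQ QA].
  apply: leq_trans (max_card _) _; apply: leq_trans (leq_addr _ _).
  by rewrite leq_pmulr // /nbad (bigD1 Q) //= QA.
rewrite big_split /= -big_distrr /= sum_nat_const card_ffun card_ord.
by rewrite [M * _]mulnC leq_add2r expnS -mulnA leq_mul2l sumbad orbT.
Qed.
End DependentRandomChoice.

(** * One round: a maximal packing by bicliques *)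

Section Round.
Variables (T : finType) (H : rel T).
Implicit Types (J : rel T) (D K Q S U W : {set T}) (P : {set {set T}}).

Definition clique_rich M s :=
  forall U, M <= #|U| -> exists Q, [/\ Q \subset U, #|Q| = s & clique H Q].

(** Each vertex of a block is joined in J to all s vertices of the other half, and
loses these edges when the block is packed; only the half Q1 is required to lie
in the set D to be served. *)
Definition biclique_block J s D K :=
  [exists Q1 : {set T}, exists Q2 : {set T},
    [&& K == Q1 :|: Q2, [disjoint Q1 & Q2], #|Q1| == s, #|Q2| == s, Q1 \subset D,
        clique H K & [forall a in Q1, forall b in Q2, J a b]]].

Lemma biclique_blockP J s D K :
  reflect (exists Q1 Q2, [/\ K = Q1 :|: Q2, [disjoint Q1 & Q2],
            #|Q1| = s /\ #|Q2| = s, Q1 \subset D &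
            clique H K /\ {in Q1 & Q2, forall a b, J a b}])
          (biclique_block J s D K).
Proof.
apply: (iffP existsP) => [[Q1 /existsP[Q2]]|[Q1 [Q2 [-> dis [s1 s2] QD [cl JQ]]]]].
  case/and5P=> /eqP-> dis /eqP s1 /eqP s2 /and3P[QD cl /forall_inP JQ].
  exists Q1, Q2; split=> //; split=> // a b aQ bQ.
  by move/forall_inP: (JQ a aQ); apply.
exists Q1; apply/existsP; exists Q2; rewrite eqxx dis s1 s2 !eqxx QD cl /=.
by apply/forall_inP => a aQ; apply/forall_inP => b bQ; apply: JQ.
Qed.

(** Dependent random choice gives a subset A of W all of whose s-subsets have at
least M common neighbours in B; both A and such a common neighbourhood are large
enough to contain a clique. *)
Lemma biclique_block_exists J W B s t M e :
  symmetric H -> irreflexive J -> subrel J H -> 0 < s -> clique_rich M s ->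
  {in W, forall w, e <= #|nbhd J w :&: B|} ->
  #|T| ^ s.+1 * M ^ t + M * #|T| ^ t < #|W| * e ^ t ->
  exists2 K : {set T}, K \subset W :|: B & biclique_block J s W K.
Proof.
move=> Hs Ji JH s0 rich We hlt.
have [A [AW MA Acom]] := dependent_random_choice s0 We hlt.
have [Q1 [Q1A Q1s Q1c]] := rich A MA.
have [Q2 [Q2B Q2s Q2c]] := rich _ (Acom Q1 Q1A Q1s).
have JQ : {in Q1 & Q2, forall a b, J a b}.
  move=> a b aQ /(subsetP Q2B); rewrite inE => /andP[_ /forall_inP]; exact.
exists (Q1 :|: Q2).
  apply: setUSS; first exact: subset_trans AW.
  by apply/subsetP => b /(subsetP Q2B); rewrite inE => /andP[].
apply/biclique_blockP; exists Q1, Q2; split=> //.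
- rewrite disjoint_subset; apply/subsetP => x x1; rewrite inE /=.
  by apply/negP => x2; have := JQ x x x1 x2; rewrite Ji.
- exact: subset_trans AW.
split=> //; apply/cliqueP => x y; rewrite !inE => /orP[]x1 /orP[]y1 xy.
- by move/cliqueP: Q1c; apply.
- by apply/JH/JQ.
- by rewrite Hs; apply/JH/JQ.
- by move/cliqueP: Q2c; apply.
Qed.

(** The last item says that a maximal packing by blocks leaves few vertices of D
with many uncovered neighbours: otherwise these vertices would yield one more
block.  The third holds because at least half of each block lies in D. *)
Lemma biclique_packing J D s t M e mu :
  symmetric H -> symmetric J -> irreflexive J -> subrel J H -> 0 < s ->
  clique_rich M s ->
  #|T| ^ s.+1 * M ^ t + M * #|T| ^ t < mu * e ^ t ->
  exists P, [/\ packing H P,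
    {in cover P, forall v, s <= #|[set y | J v y && together P v y]|},
    #|cover P| <= 2 * #|D :&: cover P| &
    #|[set w in D :\: cover P | e <= #|nbhd J w :\: cover P|]| < mu].
Proof.
move=> Hs Js Ji JH s0 rich hlt.
pose ok P := trivIset P && [forall K in P, biclique_block J s D K].
have [P] : {P | maxset ok P}.
  apply: ex_maxset; exists set0; apply/andP; split.
    by apply/trivIsetP => A B; rewrite inE.
  by apply/forall_inP => K; rewrite inE.
case/maxsetP => /andP[triv /forall_inP blk] maxP; exists P.
have memP K v : K \in P -> v \in K -> v \in cover P.
  by move=> KP vK; apply/bigcupP; exists K.
split.
- rewrite /packing triv /=; apply/forall_inP => K /blk.
  by case/biclique_blockP => Q1 [Q2 [_ _ _ _ []]].
- move=> v /bigcupP[K KP]; have /biclique_blockP := blk K KP.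
  case=> Q1 [Q2 [KE _ [s1 s2] _ [_ JQ]]] vK.
  have sub Q : Q \subset K -> {in Q, forall y, J v y} ->
      #|Q| <= #|[set y | J v y && together P v y]|.
    move=> /subsetP QK JvQ; apply/subset_leq_card/subsetP => y yQ.
    rewrite inE JvQ //=; apply/existsP; exists K.
    by rewrite KP vK QK.
  move: (vK); rewrite KE inE => /orP[v1|v2].
    rewrite -s2; apply: sub; first by rewrite KE subsetUr.
    by move=> y yQ; apply: JQ.
  rewrite -s1; apply: sub; first by rewrite KE subsetUl.
  by move=> y yQ; rewrite Js; apply: JQ.
- have -> : #|cover P| = \sum_(K in P) #|K|.
    by rewrite -sum1_card big_trivIset //=; apply: eq_bigr => K _; rewrite sum1_card.
  have -> : #|D :&: cover P| = \sum_(K in P) #|K :&: D|.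
    rewrite -sum1_card (eq_bigl (fun x => (x \in cover P) && (x \in D))).
      rewrite big_mkcondr big_trivIset //=; apply: eq_bigr => K _.
      by rewrite -sum1_card -big_mkcondr; apply: eq_bigl => x; rewrite inE.
    by move=> x; rewrite inE andbC.
  rewrite big_distrr /=; apply: leq_sum => K /blk /biclique_blockP.
  case=> Q1 [Q2 [-> dis [s1 s2] Q1D _]].
  rewrite cardsU s1 s2.
  apply: leq_trans (leq_subr _ _) _; rewrite addnn -mul2n leq_mul2l /= -s1.
  by apply: subset_leq_card; rewrite subsetI subsetUl.
rewrite ltnNge; apply/negP => muW.
set W := [set w in _ | _] in muW.
have We : {in W, forall w, e <= #|nbhd J w :&: ~: cover P|}.
  by move=> w; rewrite inE -setDE => /andP[].
have hlt' : #|T| ^ s.+1 * M ^ t + M * #|T| ^ t < #|W| * e ^ t.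
  by apply: leq_trans hlt _; rewrite leq_mul2r muW orbT.
have [K KWB Kblk] := biclique_block_exists Hs Ji JH s0 rich We hlt'.
have Wc : W \subset D :\: cover P.
  by apply/subsetP => w; rewrite inE => /andP[].
have dis : [disjoint K & cover P].
  rewrite disjoint_subset; apply: (subset_trans KWB).
  apply/subsetP => x; rewrite inE => /orP[|]; last by rewrite inE.
  by move/(subsetP Wc); rewrite !inE => /andP[].
have [x xK] : exists x, x \in K.
  case/biclique_blockP: Kblk => Q1 [Q2 [-> _ [s1 _] _ _]].
  have /card_gt0P[x x1] : 0 < #|Q1| by rewrite s1.
  by exists x; rewrite inE x1.
have KP : K \notin P.
  apply/negP => /memP/(_ xK) xc.
  by have := disjointFr dis xK; rewrite xc.
(* The new block is disjoint from the packing, against its maximality. *)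
suff /maxP/(_ (subsetUr _ _))/setP/(_ K) : ok (K |: P).
  by rewrite !inE eqxx /= (negPf KP).
apply/andP; split.
  have n0 : set0 \notin P.
    apply/negP => /blk /biclique_blockP[Q1 [Q2 [E0 _ [s1 _] _ _]]].
    have : #|Q1| <= 0.
      by rewrite -(@cards0 T); apply: subset_leq_card; rewrite E0 subsetUl.
    by rewrite s1 leqNgt s0.
  apply: (trivIsetU1 _ triv n0).1 => B BP.
  apply: disjointWr dis; apply/subsetP => y; exact: memP.
apply/forall_inP => K'; rewrite !inE => /orP[/eqP->|/blk //].
case/biclique_blockP: Kblk => Q1 [Q2 [KE d s12 Q1D cJ]].
apply/biclique_blockP; exists Q1, Q2; split=> //.
apply: (subset_trans Q1D); apply: (subset_trans Wc); exact: subsetDl.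
Qed.

End Round.

(** * One stage: halving the maximum degree *)

Section Stage.
Variables (T : finType) (H : rel T).
Variables (M s t e mu : nat).
Hypotheses (Hs : symmetric H) (s_gt0 : 0 < s) (e_gt0 : 0 < e).
Hypothesis rich : clique_rich H M s.
Hypothesis room : #|T| ^ s.+1 * M ^ t + M * #|T| ^ t < mu * e ^ t.
Hypothesis mu_small : 4 * mu <= e.
Implicit Types (J : rel T) (D K Q S U W : {set T}) (P : {set {set T}}).

(** During a stage all degrees are at most 4 e, and the next stage needs degrees of
at most 2 e: the heavy vertices are those that would have to be set aside. *)
Definition heavy J := [set v | 2 * e < #|nbhd J v|].

Definition tame J :=
  [/\ symmetric J, irreflexive J, subrel J H & forall v, #|nbhd J v| <= 4 * e].

Lemma residuals_deg J Ps v :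
  #|nbhd (foldl (@residual T) J Ps) v| <= #|nbhd J v|.
Proof. exact/subset_leq_card/sub_nbhd/residuals_sub. Qed.

Lemma residuals_tame J Ps : tame J -> tame (foldl (@residual T) J Ps).
Proof.
case=> Js Ji JH Jd; split.
- exact: residuals_sym.
- by move=> x; apply: contraFF (Ji x); apply: residuals_sub.
- by move=> x y /residuals_sub; apply: JH.
- by move=> v; apply: leq_trans (residuals_deg _ _ _) (Jd v).
Qed.

Lemma residuals_heavy J Ps : heavy (foldl (@residual T) J Ps) \subset heavy J.
Proof.
apply/subsetP => v; rewrite !inE => h.
exact: leq_trans h (residuals_deg _ _ _).
Qed.

Lemma double_count_degrees J W S : symmetric J ->
  \sum_(w in W) #|nbhd J w :&: S| <= \sum_(v in S) #|nbhd J v|.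
Proof.
move=> Js; have cE X w : #|nbhd J w :&: X| = \sum_(v in X) (J w v : nat).
  rewrite -sum1_card; under eq_bigl do rewrite !inE andbC.
  by rewrite big_mkcondr; apply: eq_bigr => v _; case: (J w v).
under eq_bigr do rewrite cE.
rewrite exchange_big /=; apply: leq_sum => v _.
under eq_bigr do rewrite Js.
by rewrite -cE subset_leq_card // subsetIl.
Qed.

(** If D is the set of heavy vertices and S the set of covered ones, almost every
vertex of D outside S has more than e neighbours in S, and S receives at most
4 e #|S| edges; this bounds D in terms of the part of D inside S.  If D has at most
e / 2 elements, then S has at most e, too few to absorb half of the more than 2 e
edges at a heavy vertex, so nearly every heavy vertex is covered. *)
Lemma serving_round J : tame J -> exists P, [/\ packing H P,
  {in cover P, forall v, #|nbhd (residual J P) v| + s <= #|nbhd J v|},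
  #|heavy J| <= mu + 9 * #|heavy J :&: cover P| &
  2 * #|heavy J| <= e -> #|heavy J :\: cover P| <= mu].
Proof.
case=> Js Ji JH Jd.
have [P [packP served coverD]] :=
  biclique_packing (heavy J) Hs Js Ji JH s_gt0 rich room.
set D := heavy J in coverD *; set S := cover P in served coverD *.
set W1 := [set w in _ | _] => W1mu.
exists P; split=> //.
- by move=> v vS; rewrite -(nbhd_residual J P v) leq_add2l served.
- have : #|(D :\: S) :\: W1| * e <= #|S| * (4 * e).
    rewrite -!sum_nat_const.
    apply: (@leq_trans (\sum_(w in D :\: S :\: W1) #|nbhd J w :&: S|)).
      apply: leq_sum => w; rewrite !inE -/S.
      case/and3P=> h1 wS wD; move: h1; rewrite wS wD /= -ltnNge => h.
      by have := cardsID S (nbhd J w); lia.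
    apply: leq_trans (double_count_degrees _ _ Js) _.
    by apply: leq_sum => v _; apply: Jd.
  rewrite mulnA leq_mul2r; case: (posnP e) e_gt0 => //= _ _ h.
  have := cardsID S D; have := cardsID W1 (D :\: S).
  have : #|(D :\: S) :&: W1| <= #|W1| by rewrite subset_leq_card // subsetIr.
  by rewrite -/S; lia.
- move=> De; apply: leq_trans (ltnW W1mu); apply/subset_leq_card/subsetP => w wDS.
  rewrite inE wDS /=; move: wDS; rewrite 2!inE => /andP[wS wD].
  have := cardsID S (nbhd J w).
  have : #|nbhd J w :&: S| <= #|S| by rewrite subset_leq_card // subsetIr.
  have : #|D :&: S| <= #|D| by rewrite subset_leq_card // subsetIl.
  by move: wD; rewrite -/S; lia.
Qed.

Lemma residual_sum J P (X : {set T}) :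
  {in cover P, forall v, #|nbhd (residual J P) v| + s <= #|nbhd J v|} ->
  \sum_(v in X) #|nbhd (residual J P) v| + #|X :&: cover P| * s <=
  \sum_(v in X) #|nbhd J v|.
Proof.
move=> served; rewrite -sum_nat_const.
have -> : \sum_(i in X :&: cover P) s = \sum_(v in X) (v \in cover P) * s.
  rewrite (eq_bigl (fun v => (v \in X) && (v \in cover P))); last first.
    by move=> v; rewrite inE.
  by rewrite big_mkcondr; apply: eq_bigr => v _; case: ifP; rewrite ?mul1n.
rewrite -big_split /=; apply: leq_sum => v _.
case: (boolP (v \in cover P)) => [/served|_]; first by rewrite mul1n.
by rewrite addn0; apply: (residuals_deg J [:: P]).
Qed.

(** A vertex has at most 4 e edges and loses s of them each time it is served; the
factor 36 is the inverse of the proportion of the initially heavy vertices that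
each round is sure to serve in [halve_heavy]. *)
Definition rounds := (144 * e) %/ s + 1.

Lemma rounds_gt : 144 * e < rounds * s.
Proof. by rewrite /rounds addn1 ltn_ceil. Qed.

(** As long as at least half of the vertices that were heavy at first remain heavy
(and their number exceeds e / 2), each round removes s #|D0| / 36 from the sum of
the degrees over the initial heavy set D0, which was at most 4 e #|D0|. *)
Lemma halve_heavy J : tame J -> exists Ps,
  [/\ all (packing H) Ps, size Ps = rounds &
      2 * #|heavy (foldl (@residual T) J Ps)| <= maxn e #|heavy J|].
Proof.
move=> tJ; set D0 := heavy J.
have key r : exists Ps, [/\ all (packing H) Ps, size Ps = r &
    let J' := foldl (@residual T) J Ps in
    2 * #|heavy J'| <= maxn e #|D0| \/
    36 * (\sum_(v in D0) #|nbhd J' v|) + r * s * #|D0| <=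
    36 * \sum_(v in D0) #|nbhd J v|].
  elim: r => [|r [Ps [pk sz /= h]]].
    by exists [::]; split=> //=; right; rewrite addn0.
  set J' := foldl _ J Ps in h; have tJ' : tame J' by apply: residuals_tame.
  have [P [packP served big _]] := serving_round tJ'.
  exists (rcons Ps P); split; rewrite ?size_rcons ?sz ?all_rcons ?packP //=.
  rewrite foldl_rcons -/J'.
  have le' : #|heavy (residual J' P)| <= #|heavy J'|.
    exact/subset_leq_card/(residuals_heavy J' [:: P]).
  case: (leqP (2 * #|heavy J'|) (maxn e #|D0|)) h => [h _|h pot].
    by left; apply: leq_trans h; rewrite leq_mul2l.
  have {}pot : 36 * \sum_(v in D0) #|nbhd J' v| + r * s * #|D0| <=
      36 * \sum_(v in D0) #|nbhd J v|.
    by case: pot => // pot; move: h; rewrite ltnNge pot.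
  right; have := residual_sum D0 served.
  have : #|heavy J' :&: cover P| <= #|D0 :&: cover P|.
    by apply/subset_leq_card/setSI/residuals_heavy.
  have : #|D0| <= 36 * #|heavy J' :&: cover P|.
    move: h big; rewrite gtn_max => /andP[]; lia.
  set a := #|heavy J' :&: _|; set b := #|D0 :&: _|; move=> D0a ab hs.
  have : #|D0| * s <= 36 * (b * s) by rewrite mulnA leq_mul2r; apply/orP; right; lia.
  by lia.
have [Ps [pk sz h]] := key rounds; exists Ps; split=> //.
case: h => //= h.
have le0 : #|heavy (foldl (@residual T) J Ps)| <= #|D0|.
  exact/subset_leq_card/residuals_heavy.
have [D00|D0_gt0] := posnP #|D0|; first by move: le0; rewrite D00; lia.
have : 36 * \sum_(v in D0) #|nbhd J v| <= 36 * (#|D0| * (4 * e)).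
  rewrite leq_mul2l -sum_nat_const; apply: leq_sum => v _.
  by case: tJ.
move/(leq_trans (leq_trans (leq_addl _ _) h)).
rewrite [36 * _]mulnCA [rounds * s * _]mulnC leq_mul2l eqn0Ngt D0_gt0 /=.
by have := rounds_gt; lia.
Qed.

Lemma shrink_heavy J h : tame J -> exists Ps,
  [/\ all (packing H) Ps, size Ps = h * rounds &
      let D := heavy (foldl (@residual T) J Ps) in
      2 * #|D| <= e \/ 2 ^ h * #|D| <= #|T|].
Proof.
move=> tJ; elim: h => [|h [Ps [pk sz hh]]].
  by exists [::]; split=> //=; right; rewrite mul1n max_card.
have [Qs [pkQ szQ hQ]] := halve_heavy (residuals_tame Ps tJ).
exists (Ps ++ Qs); split.
- by rewrite all_cat pk.
- by rewrite size_cat sz szQ mulSn addnC.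
rewrite foldl_cat /=.
have : #|heavy (foldl (@residual T) (foldl (@residual T) J Ps) Qs)| <=
       #|heavy (foldl (@residual T) J Ps)|.
  exact/subset_leq_card/residuals_heavy.
move: hQ hh => /=; set a := #|heavy (foldl _ J Ps)|; set b := #|heavy _|.
move=> hQ hh ba; case: (leqP (2 * b) e) => [|eb]; first by left.
have {}hQ : 2 * b <= a by move: hQ; rewrite leq_max leqNgt eb.
case: hh => hh; first by lia.
right; apply: leq_trans hh; rewrite expnSr -mulnA leq_mul2l hQ.
by rewrite orbT.
Qed.

(** When there are few heavy vertices, each round misses at most mu of them.  The
sum of the degrees over the vertices X that are heavy at the end thus decreases
by s (#|X| - mu) in each round, which is impossible for so many rounds if X has
more than 2 mu elements. *)
Lemma sweep_heavy J : tame J -> 2 * #|heavy J| <= e -> exists Ps,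
  [/\ all (packing H) Ps, size Ps = rounds &
      #|heavy (foldl (@residual T) J Ps)| <= 2 * mu].
Proof.
move=> tJ small.
have key r : exists Ps, [/\ all (packing H) Ps, size Ps = r &
    let J' := foldl (@residual T) J Ps in
    forall X : {set T}, X \subset heavy J' ->
    \sum_(v in X) #|nbhd J' v| + r * ((#|X| - mu) * s) <=
    \sum_(v in X) #|nbhd J v|].
  elim: r => [|r [Ps [pk sz /= h]]].
    by exists [::]; split=> //= X _; rewrite addn0.
  set J' := foldl _ J Ps in h; have tJ' : tame J' by apply: residuals_tame.
  have [P [packP served _ sweep]] := serving_round tJ'.
  exists (rcons Ps P); split; rewrite ?size_rcons ?sz ?all_rcons ?packP //=.
  rewrite foldl_rcons -/J' => X XD.
  have XD' : X \subset heavy J'.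
    by apply: (subset_trans XD); apply: (residuals_heavy J' [:: P]).
  have miss : #|X :\: cover P| <= mu.
    apply: leq_trans (sweep _); first exact/subset_leq_card/setSD.
    apply: leq_trans small; rewrite leq_mul2l /=.
    exact/subset_leq_card/residuals_heavy.
  have := h X XD'; have := residual_sum X served.
  have : (#|X| - mu) * s <= #|X :&: cover P| * s.
    by rewrite leq_mul2r; have := cardsID (cover P) X; lia.
  by rewrite mulSn; lia.
have [Ps [pk sz /= h]] := key rounds; exists Ps; split=> //.
set D := heavy _ in h *; have := h D (subxx _).
have : \sum_(v in D) #|nbhd J v| <= #|D| * (4 * e).
  by rewrite -sum_nat_const; apply: leq_sum => v _; case: tJ.
move=> h1 /(leq_trans (leq_addl _ _))/leq_trans/(_ h1) h2.
rewrite leqNgt; apply/negP => D2.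
have : #|D| * (4 * e) <= (#|D| - mu) * (8 * e).
  by rewrite [8 * e](_ : _ = 2 * (4 * e)) ?mulnA ?leq_mul2r //; lia.
move/(leq_trans h2); rewrite mulnCA leq_mul2l => /orP[|]; first by lia.
by have := rounds_gt; lia.
Qed.

(** By the hypothesis on h, halving #|T| vertices h times leaves at most e / 2. *)
Lemma stage J h : tame J -> 2 * #|T| <= 2 ^ h * e -> exists Ps,
  [/\ all (packing H) Ps, size Ps = h.+1 * rounds &
      #|heavy (foldl (@residual T) J Ps)| <= 2 * mu].
Proof.
move=> tJ hT; have [Ps [pk sz hh]] := shrink_heavy h tJ.
have [|Qs [pkQ szQ hQ]] := sweep_heavy (residuals_tame Ps tJ).
  case: hh => // hh; have := leq_mul (leqnn 2) hh.
  by rewrite mulnCA => /leq_trans/(_ hT); rewrite leq_mul2l expn_eq0.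
exists (Ps ++ Qs); split; last by rewrite foldl_cat.
- by rewrite all_cat pk.
- by rewrite size_cat sz szQ mulSn addnC.
Qed.

End Stage.

(** * All stages *)

Lemma exists_subset_card (T : finType) (Q : {set T}) k : k <= #|Q| ->
  exists A : {set T}, (A \subset Q) && (#|A| == k).
Proof.
move=> kQ; pose A := [set x in take k (enum Q)]; exists A.
have AQ : A \subset Q.
  by apply/subsetP => x; rewrite inE => /mem_take; rewrite mem_enum.
have uA : uniq (take k (enum Q)) by apply/take_uniq/enum_uniq.
rewrite AQ /A cardsE (card_uniqP uA) size_takel ?eqxx //.
by rewrite -[size _]cardE.
Qed.

Lemma clique_richS (T : finType) (H : rel T) M s s' :
  s' <= s -> clique_rich H M s -> clique_rich H M s'.
Proof.
move=> ss rich U /rich[Q [QU Qs Qc]].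
have [|A /andP[AQ /eqP As]] := @exists_subset_card _ Q s'; first by rewrite Qs.
by exists A; split; [exact: subset_trans QU | | exact: cliqueS Qc].
Qed.

(** The hypothesis of [dependent_random_choice] with M = 2^m, t = 2 s, for
2^(2m) vertices of degree at least 2^(4m+2-i) in a graph with at most 2^(4m+4)
vertices. *)
Lemma exponent_room n m i s :
  n <= 2 ^ (4 * m + 4) -> 4 <= m -> 2 <= s -> 4 * (s * (i + 2)) <= m ->
  n ^ s.+1 * (2 ^ m) ^ (2 * s) + 2 ^ m * n ^ (2 * s) <
  2 ^ (2 * m) * (2 ^ (4 * m + 2 - i)) ^ (2 * s).
Proof.
move=> nm m4 s2 sim; rewrite -!expnM -expnD.
have pow_n k : n ^ k <= 2 ^ ((4 * m + 4) * k).
  by rewrite expnM; case: k => // k; rewrite leq_exp2r.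
set X := 2 * m + _.
have im : i <= m by nia.
have hA : (4 * m + 4) * s.+1 + m * (2 * s) <= X - 2.
  by rewrite /X mulnBl; nia.
have hB : m + (4 * m + 4) * (2 * s) <= X - 2 by rewrite /X mulnBl; nia.
have X2 : 2 <= X by rewrite /X; lia.
apply: (@leq_ltn_trans (2 ^ (X - 2) + 2 ^ (X - 2))); last first.
  by rewrite addnn -mul2n -expnS ltn_exp2l //; lia.
apply: leq_add.
  apply: (@leq_trans (2 ^ ((4 * m + 4) * s.+1) * 2 ^ (m * (2 * s)))).
    by rewrite leq_mul2r pow_n orbT.
  by rewrite -expnD leq_exp2l.
apply: (@leq_trans (2 ^ m * 2 ^ ((4 * m + 4) * (2 * s)))).
  by rewrite leq_mul2l pow_n orbT.
by rewrite -expnD leq_exp2l.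
Qed.

Lemma stage_cost e l i : 0 < l %/ (i + 2) -> l <= e ->
  (i + 4) * rounds (l %/ (i + 2)) e * l <= 289 * (i + 4) ^ 2 * e.
Proof.
set s := l %/ _ => s0 le; rewrite /rounds.
have l2s : l <= 2 * s * (i + 2).
  have := ltn_ceil l (isT : 0 < i.+2); rewrite -[i.+2]addn2 -/s => h.
  apply: leq_trans (ltnW h) _; rewrite leq_mul2r; lia.
have h : (144 * e) %/ s * l <= 288 * e * (i + 2).
  have h1 := leq_trunc_div (144 * e) s.
  apply: leq_trans (leq_mul (leqnn _) l2s) _.
  move: h1; set d := _ %/ s => h1.
  have -> : d * (2 * s * (i + 2)) = 2 * (i + 2) * (d * s) by lia.
  apply: leq_trans (leq_mul (leqnn _) h1) _; lia.
have : ((144 * e) %/ s + 1) * l <= 289 * (i + 4) * e by nia.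
move=> h2; rewrite -mulnA; apply: leq_trans (leq_mul (leqnn (i + 4)) h2) _.
by rewrite expnS expn1; lia.
Qed.

(** The graph J after the deletion of the vertices in Z. *)
Definition off (T : finType) (Z : {set T}) (J : rel T) : rel T :=
  fun x y => [&& J x y, x \notin Z & y \notin Z].

(** Stage i has e = 2^(4m+2-i) and s = l / (i+2), and consists of i+4 groups of
rounds, so it costs at most 289 (i+4)^2 e / l packings.  The quadratic polynomial
in the bound is the solution of
f(i) - f(i+1) / 2 = (i+4)^2, which makes the cost telescope. *)
Lemma stages (T : finType) (H : rel T) m l i :
  symmetric H -> irreflexive H -> #|T| <= 2 ^ (4 * m + 4) ->
  clique_rich H (2 ^ m) l -> 4 <= m -> 4 * l <= m -> 2 * (i + 1) <= l ->
  exists (Ps : seq {set {set T}}) (Z : {set T}),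
  [/\ all (packing H) Ps,
      size Ps * l + 289 * (2 * i ^ 2 + 20 * i + 54) * 2 ^ (4 * m + 2 - i) <=
        289 * 54 * 2 ^ (4 * m + 2),
      #|Z| <= i * 2 ^ (2 * m + 1) &
      forall v, #|nbhd (off Z (foldl (@residual T) H Ps)) v| <=
                2 ^ (4 * m + 4 - i)].
Proof.
move=> Hs Hi Tm rich m4 lm; elim: i => [|i IH] il.
  exists [::], set0; split; rewrite ?cards0 ?subn0 //.
  by move=> v; apply: leq_trans Tm; apply: max_card.
have im : i + 2 <= m by lia.
have e4E : 2 + (4 * m + 2 - i) = 4 * m + 4 - i by lia.
have e2E : (4 * m + 2 - i.+1).+1 = 4 * m + 2 - i by lia.
have e2E' : (4 * m + 2 - i).+1 = 4 * m + 4 - i.+1 by lia.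
have mu4E : 2 + 2 * m <= 4 * m + 2 - i by lia.
have ThE : i + 3 + (4 * m + 2 - i) = (4 * m + 4).+1 by lia.
have le_e : l <= 4 * m + 2 - i by lia.
have [|Ps [Z [pk cost Zs Jd]]] := IH; first by lia.
set J := off Z _ in Jd; pose s := l %/ (i + 2).
pose e := 2 ^ (4 * m + 2 - i).
have s2 : 2 <= s by rewrite /s leq_divRL; lia.
have sil : s * (i + 2) <= l by apply: leq_trunc_div.
have e_gt0 : 0 < e by rewrite expn_gt0.
have e4 : 4 * e = 2 ^ (4 * m + 4 - i).
  by rewrite -[4 in LHS]/(2 ^ 2) -expnD e4E.
have tJ : tame H e J.
  split.
  - by move=> x y; rewrite /J /off residuals_sym // [(x \notin Z) && _]andbC.
  - move=> x; apply: contraFF (Hi x) => /andP[+ _]; exact: residuals_sub.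
  - by move=> x y /andP[+ _]; apply: residuals_sub.
  - by move=> v; rewrite e4.
have rich_s : clique_rich H (2 ^ m) s by apply: clique_richS rich; apply: leq_div.
have room := exponent_room Tm m4 s2 (leq_trans (leq_mul (leqnn 4) sil) lm).
have mu4 : 4 * 2 ^ (2 * m) <= e.
  by rewrite -[X in X * _]/(2 ^ 2) -expnD leq_exp2l.
have Th : 2 * #|T| <= 2 ^ (i + 3) * e.
  by rewrite -expnD ThE [leqRHS]expnS leq_mul2l Tm.
have [Qs [pkQ szQ hQ]] := stage Hs (ltnW s2) e_gt0 rich_s room mu4 tJ Th.
set D := heavy e _ in hQ.
exists (Ps ++ Qs), (Z :|: D); split.
- by rewrite all_cat pk.
- have le : l <= e.
    apply: leq_trans (ltnW (ltn_expl l (isT : 1 < 2))) _.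
    by rewrite leq_exp2l.
  have := stage_cost (ltnW s2 : 0 < l %/ (i + 2)) le.
  rewrite size_cat szQ mulnDl -/s -[(i + 3).+1]addnS.
  have : e = 2 * 2 ^ (4 * m + 2 - i.+1).
    by rewrite -expnS e2E.
  move: cost; rewrite -/e; set e' := 2 ^ (_ - i.+1) => cost ee.
  rewrite ee in cost *; move: cost; clear; nia.
- rewrite cardsU; apply: leq_trans (leq_subr _ _) _.
  rewrite mulSn addnC leq_add //.
  by rewrite addn1 expnS.
move=> v; have [vZ|vZ] := boolP (v \in Z :|: D).
  rewrite (_ : nbhd _ _ = set0) ?cards0 //; apply/setP => y.
  by rewrite !inE /off vZ andbF.
have [vZ' vD] : v \notin Z /\ v \notin D by apply/norP; rewrite -in_setU.
have -> : 2 ^ (4 * m + 4 - i.+1) = 2 * e by rewrite -expnS e2E'.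
move: vD; rewrite inE -leqNgt; apply: leq_trans.
apply/subset_leq_card/subsetP => y; rewrite !inE /off.
rewrite foldl_cat !(residualsE _ Qs) => /and3P[/andP[Jvy ->] _].
by rewrite inE negb_or /J /off Jvy vZ' => /andP[->].
Qed.

(** * Greedy colouring of the remaining edges *)

Lemma leq_card_bigcup (I T : finType) (P : pred I) (X : I -> {set T}) :
  #|\bigcup_(i | P i) X i| <= \sum_(i | P i) #|X i|.
Proof.
elim/big_rec2: _ => [|i n U _ Un]; first by rewrite cards0.
by apply: leq_trans (leq_card_setU _ _) _; rewrite leq_add2l.
Qed.

Section Greedy.
Variable T : finType.
Implicit Types (K Q U Z : {set T}) (F P : {set {set T}}).

(** Members of F that meet are given different colours, one member after the
other. *)
Lemma greedy_colouring F d :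
  {in F, forall K, #|[set K' in F | K' != K & ~~ [disjoint K & K']]| <= d} ->
  exists c : {set T} -> 'I_d.+1,
    {in F &, forall K K', K != K' -> c K = c K' -> [disjoint K & K']}.
Proof.
move=> Fd; suff: forall r : seq {set T}, {subset r <= F} ->
    exists c : {set T} -> 'I_d.+1, {in r &, forall K K', K != K' -> c K = c K' ->
      [disjoint K & K']}.
  move=> /(_ (enum F))[|c hc].
    by move=> K; rewrite mem_enum.
  by exists c => K K' KF KF'; apply: hc; rewrite mem_enum.
elim=> [|K r IH] rF; first by exists (fun=> ord0).
have [|c hc] := IH; first by move=> K' K'r; apply: rF; rewrite inE K'r orbT.
pose N := [set K' in F | K' != K & ~~ [disjoint K & K']].
have [j jN] : exists j, j \notin [set c K' | K' in N].
  apply/existsP; rewrite -negb_forall; apply/negP => /forallP all_j.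
  have : #|'I_d.+1| <= #|[set c K' | K' in N]|.
    by apply/subset_leq_card/subsetP => i _; apply: all_j.
  have KF : K \in F by apply: rF; rewrite inE eqxx.
  rewrite card_ord ltnNge; move/negP; apply.
  exact: leq_trans (leq_imset_card _ _) (Fd K KF).
have new K' : K' \in r -> K' != K -> c K' = j -> [disjoint K & K'].
  move=> K'r K'K cj; apply: contraNT jN => nd; rewrite -cj imset_f //.
  by rewrite inE K'K nd rF ?inE ?K'r ?orbT.
exists (fun K' => if K' == K then j else c K') => K1 K2.
rewrite !inE; have [->|K1K] := eqVneq K1 K; have [->|K2K] := eqVneq K2 K => //=.
- by move=> _ K2r _ /esym; apply: new.
- by move=> K1r _ _; rewrite disjoint_sym; apply: new.
- exact: hc.
Qed.

Lemma greedy_packings (H : rel T) F d :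
  {in F, forall K, clique H K} ->
  {in F, forall K, #|[set K' in F | K' != K & ~~ [disjoint K & K']]| <= d} ->
  exists Ps, [/\ all (packing H) Ps, size Ps = d.+1 &
    forall x y, together F x y -> has (fun P => together P x y) Ps].
Proof.
move=> Fc /greedy_colouring[c hc].
exists [seq [set K in F | c K == j] | j : 'I_d.+1]; split.
- apply/allP => P /mapP[j _ ->]; apply/andP; split.
    apply/trivIsetP => K K'; rewrite !inE => /andP[KF /eqP cK] /andP[K'F /eqP cK'] KK'.
    by apply: hc; rewrite ?cK ?cK'.
  by apply/forall_inP => K; rewrite inE => /andP[/Fc].
- by rewrite size_map size_enum_ord.
move=> x y /existsP[K /andP[KF xyK]]; apply/hasP.
exists [set K' in F | c K' == c K]; first by apply: image_f.
by apply/existsP; exists K; rewrite inE KF eqxx.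
Qed.

(** Remove cliques of size l while at least M vertices are left, and take the last
vertices as singletons. *)
Lemma clique_partition (H : rel T) M l U : 0 < l -> clique_rich H M l ->
  exists P, [/\ partition P U, {in P, forall K, clique H K /\ #|K| <= l} &
    #|P| * l <= #|U| + M * l].
Proof.
move=> l_gt0 rich; have [n] := ubnP #|U|; elim: n U => // n IH U Un.
have [MU|UM] := leqP M #|U|; last first.
  exists [set [set x] | x in U]; split.
  - have [triv inj] : trivIset [set [set x] | x in U] /\
      {in mem U &, injective (@set1 T)}.
      apply: trivIimset => [x y _ _ yx|].
        by rewrite disjoints1 inE eq_sym.
      by apply/imsetP => -[x _ /setP/(_ x)]; rewrite !inE eqxx.
    apply/and3P; split=> //.
      apply/eqP/setP => x; apply/bigcupP/idP => [[_ /imsetP[y yU ->]]|xU].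
        by rewrite inE => /eqP->.
      by exists [set x]; rewrite ?imset_f ?inE.
    by apply/imsetP => -[x _ /setP/(_ x)]; rewrite !inE eqxx.
  - move=> _ /imsetP[x _ ->]; rewrite cards1; split=> //.
    by apply/cliqueP => a b; rewrite !inE => /eqP-> /eqP->; rewrite eqxx.
  - apply: leq_trans (leq_addl _ _); rewrite leq_mul2r.
    by rewrite (leq_trans (leq_imset_card _ _)) ?orbT // ltnW.
have [Q [QU Ql Qc]] := rich U MU.
have UE := cardsID Q U; rewrite (setIidPr QU) Ql in UE.
have [|P [pP Pc Pl]] := IH (U :\: Q); first by lia.
exists (Q |: P); split.
- rewrite -[U](setID _ Q) (setIidPr QU); apply: partitionU1 => //.
    by rewrite -card_gt0 Ql.
  by rewrite disjoint_subset; apply/subsetP => x xQ; rewrite !inE xQ.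
- by move=> K; rewrite !inE => /orP[/eqP->|/Pc //]; rewrite Ql.
have : #|Q |: P| <= #|P|.+1.
  by rewrite cardsU1; case: (Q \notin P); rewrite ?add1n ?add0n.
by move=> h; apply: leq_trans (leq_mul h (leqnn l)) _; lia.
Qed.

(** The members to be coloured are the uncovered edges with both or no ends in Z,
and the stars z |: Q for z in Z and Q in a partition of the neighbours of z outside
Z into cliques.  A vertex outside Z is in at most one star for each centre, and
only the centre of a star, its single vertex in Z, is in many stars.  Hence every
member meets few others. *)
Lemma finish_cover (H R : rel T) Z B M l :
  symmetric H -> symmetric R -> subrel R H -> 0 < l -> clique_rich H M l ->
  irreflexive H ->
  (forall v, #|nbhd (off Z R) v| <= B) -> #|Z| <= B ->
  exists Ps, [/\ all (packing H) Ps,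
    size Ps = (2 * (#|T| %/ l + M) + (2 * l + 4) * B).+1 &
    forall x y, R x y -> has (fun P => together P x y) Ps].
Proof.
move=> Hs Rs RH l_gt0 rich Hi degB ZB.
have [part partP] : exists part : T -> {set {set T}}, forall z,
    [/\ partition (part z) (nbhd H z :\: Z),
        {in part z, forall K, clique H K /\ #|K| <= l} &
        #|part z| <= #|T| %/ l + M].
  apply: (@fin_all_exists T (fun=> {set {set T}})
    (fun z P => [/\ partition P (nbhd H z :\: Z),
        {in P, forall K, clique H K /\ #|K| <= l} & #|P| <= #|T| %/ l + M])) => z.
  have [P [pP Pc Pl]] := clique_partition (nbhd H z :\: Z) l_gt0 rich.
  exists P; split=> //; rewrite -divnDMl // leq_divRL //.
  by apply: leq_trans Pl _; rewrite leq_add2r max_card.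
set M' := _ + M in partP *.
have partZ z Q : Q \in part z -> {in Q, forall y, H z y /\ y \notin Z}.
  have [/and3P[/eqP cov _ _] _ _] := partP z => Qz y yQ.
  have : y \in cover (part z) by apply/bigcupP; exists Q.
  by rewrite cov !inE => /andP[].
pose L := [set u : T * T | R u.1 u.2 && ((u.1 \in Z) == (u.2 \in Z))].
pose short := [set [set u.1; u.2] | u in L].
pose star z := [set z |: Q | Q in part z].
pose F := short :|: \bigcup_(z in Z) star z.
have Lsym x y : (x, y) \in L -> (y, x) \in L.
  by rewrite !inE /= Rs eq_sym.
have Ldeg v : #|[set y | (v, y) \in L]| <= B.
  have [vZ|vZ] := boolP (v \in Z).
    apply: leq_trans ZB; apply/subset_leq_card/subsetP => y.
    by rewrite !inE /= vZ => /andP[_ /eqP <-].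
  apply: leq_trans (degB v); apply/subset_leq_card/subsetP => y.
  by rewrite !inE /= /off (negPf vZ) => /andP[-> /eqP <-].
have shortdeg v : #|[set K in short | v \in K]| <= B.
  apply: leq_trans (Ldeg v).
  apply: leq_trans (leq_imset_card (fun y => [set v; y]) _).
  apply/subset_leq_card/subsetP => K; rewrite inE => /andP[/imsetP[[x y] uL ->]] /=.
  rewrite !inE => /orP[/eqP->|/eqP->].
    by apply: (imset_f (fun z => [set x; z])); move: uL; rewrite !inE.
  rewrite setUC; apply: (imset_f (fun z => [set y; z])).
  by move: (Lsym _ _ uL); rewrite !inE.
have starP z K : K \in star z -> exists2 Q, Q \in part z & K = z |: Q.
  by case/imsetP => Q; exists Q.
have stardegZ v : v \in Z ->
    #|[set K in \bigcup_(z in Z) star z | v \in K]| <= M'.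
  move=> vZ; have [_ _ pv] := partP v; apply: leq_trans pv.
  apply: leq_trans (leq_imset_card (fun Q => v |: Q) _).
  apply/subset_leq_card/subsetP => K; rewrite inE => /andP[/bigcupP[z zZ Ks] vK].
  suff -> : v = z by [].
  case: (starP z K Ks) vK => Q Qz ->; rewrite !inE => /orP[/eqP //|vQ].
  by case: (partZ z Q Qz v vQ) => _; rewrite vZ.
have stardeg v : v \notin Z ->
    #|[set K in \bigcup_(z in Z) star z | v \in K]| <= B.
  move=> vZ; apply: leq_trans ZB.
  apply: leq_trans (leq_imset_card (fun z => z |: pblock (part z) v) _).
  apply/subset_leq_card/subsetP => K; rewrite inE => /andP[/bigcupP[z zZ Ks] vK].
  apply/imsetP; exists z => //; have [Q Qz KE] := starP z K Ks.
  rewrite KE; congr (_ |: _); apply/esym/def_pblock => //.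
    by have [/and3P[]] := partP z.
  move: vK; rewrite KE !inE => /orP[/eqP vz|//].
  by rewrite vz zZ in vZ.
have Fdeg v : #|[set K in F | v \in K]| <=
    B + #|[set K in \bigcup_(z in Z) star z | v \in K]|.
  apply: leq_trans (leq_add (shortdeg v) (leqnn _)).
  apply: leq_trans (leq_card_setU _ _); apply/subset_leq_card/subsetP => K.
  by rewrite !inE => /andP[/orP[]-> ->]; rewrite ?orbT.
have FdegZ v : #|[set K in F | v \in K]| <= 2 * B + M'.
  apply: leq_trans (Fdeg v) _; have [/stardegZ|/stardeg] := boolP (v \in Z); lia.
have conflict K : #|[set K' in F | K' != K & ~~ [disjoint K & K']]| <=
    \sum_(v in K) #|[set K' in F | v \in K']|.
  apply: leq_trans (leq_card_bigcup _ _).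
  apply/subset_leq_card/subsetP => K'; rewrite inE => /and3P[K'F _].
  rewrite -setI_eq0 => /set0Pn[v]; rewrite inE => /andP[vK vK'].
  by apply/bigcupP; exists v => //; rewrite inE K'F.
have [||Ps [pk sz hP]] := @greedy_packings H F (2 * M' + (2 * l + 4) * B).
- move=> K; rewrite inE => /orP[/imsetP[[x y]]|/bigcupP[z zZ /starP[Q Qz ->]]].
    rewrite !inE /= => /andP[/RH xy _] ->; apply/cliqueP => a b.
    by rewrite !inE => /orP[]/eqP-> /orP[]/eqP->; rewrite ?eqxx // Hs.
  have [_ /(_ Q Qz)[/cliqueP Qc _] _] := partP z; apply/cliqueP => a b.
  rewrite !inE => /orP[/eqP->|aQ] /orP[/eqP->|bQ]; rewrite ?eqxx // => ab.
  + by case: (partZ z Q Qz b bQ).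
  + by rewrite Hs; case: (partZ z Q Qz a aQ).
  + exact: Qc.
- move=> K KF; apply: leq_trans (conflict K) _.
  move: KF; rewrite inE => /orP[/imsetP[[x y]]|/bigcupP[z zZ /starP[Q Qz ->]]].
    rewrite inE /= => /andP[xy _] ->.
    have xy' : x != y by apply: contraTneq (RH _ _ xy) => ->; rewrite Hi.
    rewrite big_setU1 ?inE //= big_set1.
    by rewrite mulnDl; apply: leq_trans (leq_add (FdegZ x) (FdegZ y)) _; lia.
  have [_ /(_ Q Qz)[_ Ql] _] := partP z.
  have zQ : z \notin Q.
    by apply/negP => /(partZ z Q Qz)[]; rewrite Hi.
  rewrite big_setU1 //=.
  have Qsum : \sum_(v in Q) #|[set K' in F | v \in K']| <= l * (2 * B).
    apply: (@leq_trans (\sum_(v in Q) (2 * B))); last first.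
      by rewrite sum_nat_const leq_mul2r Ql orbT.
    apply: leq_sum => v /(partZ z Q Qz)[_ /stardeg h].
    by apply: leq_trans (Fdeg v) _; lia.
  by rewrite mulnDl; apply: leq_trans (leq_add (FdegZ z) Qsum) _; lia.
exists Ps; split=> // x y Rxy; apply: hP; apply/existsP.
have mixed a b : H a b -> a \in Z -> b \notin Z ->
    exists K, [&& K \in F, a \in K & b \in K].
  move=> Hab aZ bZ; have [/and3P[/eqP cov _ _] _ _] := partP a.
  have : b \in cover (part a) by rewrite cov !inE Hab bZ.
  case/bigcupP => Q Qa bQ; exists (a |: Q); rewrite !inE eqxx bQ orbT !andbT.
  apply/orP; right; apply/bigcupP; exists a => //; exact: imset_f.
have [xZ|xZ] := boolP (x \in Z); have [yZ|yZ] := boolP (y \in Z).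
- exists [set x; y]; rewrite !inE !eqxx orbT !andbT; apply/orP; left.
  by apply/imsetP; exists (x, y); rewrite // inE /= Rxy xZ yZ.
- exact: mixed (RH _ _ Rxy) xZ yZ.
- have [|K /and3P[KF yK xK]] := mixed y x _ yZ xZ; first by rewrite Hs RH.
  by exists K; rewrite KF xK.
- exists [set x; y]; rewrite !inE !eqxx orbT !andbT; apply/orP; left.
  by apply/imsetP; exists (x, y); rewrite // inE /= Rxy (negPf xZ) (negPf yZ).
Qed.
End Greedy.

(** * Covering a clique-rich graph *)

Lemma sqr_le_exp_half l : 20 <= l -> l ^ 2 <= 2 ^ (l %/ 2 - 1).
Proof.
move=> l20; set k := l %/ 2 - 1.
have [lk k9] : l <= 2 * k + 3 /\ 9 <= k by rewrite /k; lia.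
clearbody k; apply: (@leq_trans ((2 * k + 3) ^ 2)); first by rewrite leq_exp2r.
elim: k k9 {lk} => // k IH; rewrite leq_eqVlt => /orP[/eqP<- //|k9].
by rewrite expnS; move: (IH k9); rewrite !expnS !expn0; nia.
Qed.

(** After l / 2 - 1 stages the remaining degrees are at most 2^(4m+4) / 2^(l/2-1),
hence at most 16 2^(4m) / l^2, and so is the size of Z.  Therefore the stars, which
have up to l + 1 vertices, meet only O(2^(4m) / l) other members in the greedy
colouring. *)
Lemma clique_packing_cover : exists C, forall (T : finType) (H : rel T) m l,
  symmetric H -> irreflexive H ->
  #|T| <= 2 ^ (4 * m + 4) -> clique_rich H (2 ^ m) l ->
  20 <= l -> 4 * l <= m ->
  exists Ps, [/\ all (packing H) Ps, size Ps * l <= C * 2 ^ (4 * m) &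
    forall x y, H x y -> has (fun P => together P x y) Ps].
Proof.
exists (289 * 54 * 2 ^ 2 + 131) => T H m l Hs Hi Tm rich l20 lm.
set I := l %/ 2 - 1.
have [m4 l_gt0 Il] : [/\ 4 <= m, 0 < l & 2 * (I + 1) <= l] by rewrite /I; split; lia.
have l2I : l ^ 2 <= 2 ^ I by apply: sqr_le_exp_half.
have lE : l ^ 2 = l * l by rewrite expnS expn1.
have Im : I <= m by lia.
have [Ps [Z [pk cost Zs degs]]] := stages Hs Hi Tm rich m4 lm Il.
set R := foldl _ H Ps in degs.
pose B := maxn (2 ^ (4 * m + 4 - I)) (I * 2 ^ (2 * m + 1)).
have B1 v : #|nbhd (off Z R) v| <= B by apply: leq_trans (degs v) (leq_maxl _ _).
have B2 : #|Z| <= B by apply: leq_trans Zs (leq_maxr _ _).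
have Bl : l ^ 2 * B <= 16 * 2 ^ (4 * m).
  rewrite /B maxnMr geq_max; apply/andP; split.
    apply: leq_trans (leq_mul l2I (leqnn _)) _.
    rewrite -expnD -[16]/(2 ^ 4) -expnD leq_exp2l //.
    move: Im m4; clear; lia.
  have lm2 : l ^ 2 <= 2 ^ m by apply: leq_trans l2I _; rewrite leq_exp2l.
  have Im2 : I <= 2 ^ m by apply: leq_trans Im (ltnW (ltn_expl _ _)).
  apply: (@leq_trans (2 ^ m * (2 ^ m * 2 ^ (2 * m + 1)))).
    by rewrite leq_mul // leq_mul2r Im2 orbT.
  rewrite -[16]/(2 ^ 4) -!expnD leq_exp2l //.
  move: m4; clear; lia.
have Rs : symmetric R by apply: residuals_sym.
have RH : subrel R H by apply: residuals_sub.
have [Qs [pkQ szQ covQ]] := finish_cover Hs Rs RH l_gt0 rich Hi B1 B2.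
exists (Ps ++ Qs); split.
- by rewrite all_cat pk.
- rewrite size_cat !mulnDl -mulnA [2 ^ 2 * _]mulnC -expnD.
  apply: leq_add; first exact: leq_trans (leq_addr _ _) cost.
  have h1 : #|T| %/ l * l <= 16 * 2 ^ (4 * m).
    apply: leq_trans (leq_trunc_div _ _) _; apply: leq_trans Tm _.
    by rewrite addnC expnD.
  have h2 : 2 ^ m * l <= 2 ^ (4 * m).
    apply: (@leq_trans (2 ^ m * 2 ^ m)).
      rewrite leq_mul2l; apply/orP; right.
      by apply: leq_trans (ltnW (ltn_expl m (isT : 1 < 2))); move: lm; clear; lia.
    by rewrite -expnD leq_exp2l //; move: m4; clear; lia.
  have h3 : l <= 2 ^ (4 * m).
    by apply: leq_trans h2; rewrite leq_pmull // expn_gt0.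
  rewrite szQ; move: h1 h2 h3 Bl l20; rewrite lE; clear.
  set X := 2 ^ (4 * m); set a := _ %/ l => h1 h2 h3 Bl l20.
  have : (2 * l + 4) * B * l <= 6 * (l * l * B).
    have -> : 6 * (l * l * B) = 6 * l * (B * l) by lia.
    by rewrite -mulnA leq_mul2r; apply/orP; right; lia.
  by rewrite mulSn mulnDl -mulnA mulnDl; lia.
move=> x y Hxy; rewrite has_cat; case: (boolP (has _ Ps)) => //= nP.
by apply: covQ; rewrite /R residualsE Hxy.
Qed.

(** * Packings and the Prague dimension *)

Section Embedding.
Variables (T : finType) (G : graph T).
Implicit Types (P : {set {set T}}).

Definition non_adj : rel T := fun x y => (x != y) && ~~ adj G x y.

Lemma non_adj_sym : symmetric non_adj.
Proof. by move=> x y; rewrite /non_adj eq_sym adj_sym. Qed.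

Lemma non_adj_irrefl : irreflexive non_adj.
Proof. by move=> x; rewrite /non_adj eqxx. Qed.

(** The classes of the partition of T given by a packing and singletons; the empty
packing yields the coordinate that separates all vertices. *)
Definition block P x := if x \in cover P then pblock P x else [set x].

Lemma block_eq P x y : trivIset P -> x != y ->
  (block P x == block P y) = together P x y.
Proof.
move=> triv xy; apply/eqP/existsP => [|[K /and3P[KP xK yK]]].
  rewrite /block; case: ifPn => [xc|xc]; case: ifPn => [yc|yc].
  - move=> E; exists (pblock P x); rewrite pblock_mem // mem_pblock xc /=.
    by rewrite E mem_pblock.
  - move=> E; have : x \in pblock P x by rewrite mem_pblock.
    by rewrite E inE (negPf xy).
  - move=> E; have : y \in pblock P y by rewrite mem_pblock.
    by rewrite -E inE eq_sym (negPf xy).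
  - by move/set1_inj/eqP; rewrite (negPf xy).
have mem z : z \in K -> z \in cover P by move=> zK; apply/bigcupP; exists K.
by rewrite /block !mem // !(def_pblock triv KP).
Qed.

(** One coordinate for each packing, preceded by one for the empty packing, which
makes the map injective and accounts for the additional 1. *)
Lemma prague_dim_le_cover (Ps : seq {set {set T}}) : all (packing non_adj) Ps ->
  (forall x y, non_adj x y -> has (fun P => together P x y) Ps) ->
  prague_dim G <= (size Ps).+1.
Proof.
move=> /allP pk cov; rewrite /prague_dim; case: ex_minnP => d _; apply.
apply/asboolP; pose Q := set0 :: Ps; exists (fun=> #|{: {set T}}|).
exists (fun x => [ffun i : 'I_(size Ps).+1 => enum_rank (block (nth set0 Q i) x)]).
have block0 x : block set0 x = [set x].
  rewrite /block ifF //; apply/negP => /bigcupP[K].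
  by rewrite inE.
split=> [x y /ffunP/(_ ord0)|x y].
  by rewrite !ffunE /= => /enum_rank_inj; rewrite !block0 => /set1_inj.
apply/idP/forallP => [xy i|xy].
  rewrite /complete_rel !ffunE (inj_eq enum_rank_inj).
  have x_y : x != y by apply: contraTneq xy => ->; rewrite adj_irrefl.
  case: i => -[|i] iP /=; first by rewrite !block0 (inj_eq set1_inj).
  have /pk /andP[triv /forall_inP clq] : nth set0 Ps i \in Ps by apply: mem_nth.
  rewrite block_eq //; apply/negP => /existsP[K /and3P[KP xK yK]].
  by have /cliqueP/(_ x y xK yK x_y)/andP[_] := clq K KP; rewrite xy.
have x_y : x != y.
  have := xy ord0; rewrite /complete_rel !ffunE (inj_eq enum_rank_inj) /=.
  by rewrite !block0 (inj_eq set1_inj).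
apply: contraT => nxy; have /hasP[P PPs] := cov x y (introT andP (conj x_y nxy)).
have iP : index P Ps < size Ps by rewrite index_mem.
have := xy (lift ord0 (Ordinal iP)).
rewrite /complete_rel !ffunE (inj_eq enum_rank_inj) /=.
rewrite nth_index // block_eq; first by move=> /negPf->.
  by have /andP[] := pk P PPs.
exact: x_y.
Qed.

(** Every other vertex that is not adjacent to v agrees with v in some coordinate,
and the vertices that agree with v in a given coordinate are pairwise
non-adjacent. *)
Lemma degree_le_prague_dim k v :
  (forall K : {set T}, clique non_adj K -> #|K| <= k) ->
  #|nbhd non_adj v| <= prague_dim G * k.
Proof.
move=> clq; rewrite /prague_dim; case: ex_minnP => d /asboolP[m [f [finj fadj]]] _.
pose K (i : 'I_d) := [set y | f y i == f v i].
apply: (@leq_trans #|\bigcup_(i in 'I_d) K i|).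
  apply/subset_leq_card/subsetP => y; rewrite inE /non_adj adj_sym fadj.
  case/andP=> vy /forallPn[i]; rewrite negbK => E.
  by apply/bigcupP; exists i; rewrite // inE.
apply: leq_trans (leq_card_bigcup _ _) _.
rewrite -[in leqRHS](card_ord d) -sum_nat_const; apply: leq_sum => i _.
apply: clq; apply/cliqueP => x y; rewrite !inE => /eqP xv /eqP yv xy.
rewrite /non_adj xy fadj; apply/forallPn; exists i.
by rewrite negbK xv yv.
Qed.
End Embedding.

(** * Typical graphs *)

(** Every vertex of U has fewer than a proportion 1 / L of U among its
H-neighbours. *)
Definition sparse (T : finType) (H : rel T) L (U : {set T}) :=
  [forall v in U, L * #|nbhd H v :&: U| < #|U|].

(** Choose a vertex of high degree in U, and continue among its neighbours in U:
the set shrinks by a factor of at most L in each of the l steps. *)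
Lemma clique_rich_dense (T : finType) (H : rel T) k L l :
  symmetric H -> irreflexive H -> 0 < L ->
  (forall U : {set T}, k <= #|U| -> ~~ sparse H L U) ->
  clique_rich H (k * L ^ l) l.
Proof.
move=> Hs Hi L0 dense; elim: l => [|l IH] U hU.
  exists set0; rewrite sub0set cards0; split=> //.
  by apply/cliqueP => x y; rewrite inE.
have /dense : k <= #|U| by apply: leq_trans hU; rewrite leq_pmulr // expn_gt0 L0.
case/forall_inPn => v vU; rewrite -leqNgt => Uv.
have [|Q [QU Ql Qc]] := IH (nbhd H v :&: U).
  by rewrite -(leq_pmul2l L0) mulnCA -expnS; apply: leq_trans Uv.
have Hv y : y \in Q -> H v y by move/(subsetP QU); rewrite !inE => /andP[].
exists (v |: Q); split.
- by rewrite subUset sub1set vU (subset_trans QU) // subsetIr.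
- by rewrite cardsU1 Ql (contraFN (Hv v) (Hi v)).
- apply/cliqueP => x y; rewrite !inE => /orP[/eqP->|xQ] /orP[/eqP->|yQ].
  + by rewrite eqxx.
  + by move=> _; apply: Hv.
  + by move=> _; rewrite Hs; apply: Hv.
  + by move/cliqueP: Qc; apply.
Qed.

(** Here n is at most 2^N and j depends on p only.  With these constants each of the
two conditions fails with probability at most 2^(-N). *)
Definition typical n j N (G : graph 'I_n) :=
  ~~ [exists U : {set 'I_n}, (24 * j * N <= #|U|)%N && sparse (non_adj G) (4 * j) U] &&
  ~~ [exists K : {set 'I_n}, (#|K| == (6 * j * N).+1) && clique (non_adj G) K].

Lemma exp_half_dominates j m : 0 < j -> 160 * j <= m ->
  24 * j * (4 * m + 4) <= 2 ^ (m %/ 2).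
Proof.
move=> j0 jm; set t := m %/ 4.
have [mt tj t7] : [/\ m <= 4 * t + 3, 24 * j <= t & 7 <= t].
  by rewrite /t; split; lia.
have h1 : 24 * j <= 2 ^ t by apply: leq_trans tj (ltnW (ltn_expl _ _)).
have h2 : 4 * m + 4 <= 2 ^ t.
  apply: (@leq_trans (16 * t + 16)); first by lia.
  elim: t t7 {mt tj h1} => // t IH; rewrite leq_eqVlt => /orP[/eqP<- //|t7].
  by rewrite expnS; have := IH t7; lia.
apply: leq_trans (leq_mul h1 h2) _; rewrite -expnD leq_exp2l //.
by rewrite /t; lia.
Qed.

(** With l = m / (8 j), both 24 j N and (4 j)^l are at most 2^(m/2), so a typical
graph has a complement that is clique-rich for sets of size 2^m.  The lower bound
uses a vertex with at least n / (4 j) neighbours in the complement. *)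
Lemma typical_bounds : exists C, forall n m j (G : graph 'I_n),
  0 < j -> 160 * j <= m -> 2 ^ (4 * m) <= n -> n <= 2 ^ (4 * m + 4) ->
  typical j (4 * m + 4) G ->
  n <= 192 * j ^ 2 * m * prague_dim G /\ prague_dim G * m <= 16 * j * C * n.
Proof.
have [C cover_bound] := clique_packing_cover.
exists C.+1 => n m j G j0 jm nlo nhi /andP[/existsPn nosparse /existsPn noclique].
set N := 4 * m + 4 in nosparse noclique.
have dom := exp_half_dominates j0 jm.
have m0 : 0 < m by apply: leq_trans jm; rewrite muln_gt0.
have mn : m <= n.
  apply: leq_trans nlo; apply: leq_trans (ltnW (ltn_expl m (isT : 1 < 2))) _.
  by rewrite leq_exp2l //; lia.
have dense (U : {set 'I_n}) : 24 * j * N <= #|U| -> ~~ sparse (non_adj G) (4 * j) U.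
  by move=> hU; have := nosparse U; rewrite hU.
have kn : 24 * j * N <= n.
  apply: leq_trans dom _; apply: leq_trans nlo; rewrite leq_exp2l //; lia.
split.
  have small (K : {set 'I_n}) : clique (non_adj G) K -> #|K| <= 6 * j * N.
    move=> Kc; rewrite leqNgt; apply/negP => bigK.
    have [A /andP[AK /eqP Ak]] := exists_subset_card bigK.
    by have := noclique A; rewrite Ak eqxx (cliqueS AK Kc).
  have /forall_inPn[v _] : ~~ sparse (non_adj G) (4 * j) [set: 'I_n].
    by apply: dense; rewrite cardsT card_ord.
  rewrite -leqNgt cardsT card_ord setIT => degv.
  have := degree_le_prague_dim v small; set d := prague_dim G => h.
  apply: leq_trans degv _; apply: leq_trans (leq_mul (leqnn _) h) _.
  rewrite expnS expn1 /N; move: m0; clear => m0.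
  have : 4 * j * (d * (6 * j * (4 * m + 4))) = 24 * (j * j) * d * (4 * m + 4) by lia.
  move=> ->; have -> : 192 * (j * j) * m * d = 24 * (j * j) * d * (8 * m) by lia.
  by rewrite leq_mul2l; apply/orP; right; lia.
pose l := m %/ (8 * j).
have [l20 lm ml] : [/\ 20 <= l, 4 * l <= m & m <= 16 * j * l].
  have j8 : 0 < 8 * j by rewrite muln_gt0.
  have l20 : 20 <= l by rewrite /l leq_divRL //; lia.
  have h1 : l * (8 * j) <= m by apply: leq_trunc_div.
  have h2 : m < l.+1 * (8 * j) by apply: ltn_ceil.
  by split=> //; nia.
have rich : clique_rich (non_adj G) (2 ^ m) l.
  move=> U hU; apply: (clique_rich_dense (L := 4 * j) _ _ _ dense).
  - exact: non_adj_sym.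
  - exact: non_adj_irrefl.
  - by rewrite muln_gt0.
  apply: leq_trans hU.
  have -> : m = m %/ 2 + (m - m %/ 2) by lia.
  rewrite expnD; apply: leq_mul; first by rewrite /N.
  apply: (@leq_trans ((2 ^ (4 * j)) ^ l)).
    have l0 : 0 < l by lia.
    by rewrite leq_exp2r // ltnW // ltn_expl.
  rewrite -expnM leq_exp2l //.
  have : l * (8 * j) <= m by apply: leq_trunc_div.
  by lia.
have [|Ps [pk sz cov]] :=
  cover_bound _ _ _ _ (@non_adj_sym _ G) (@non_adj_irrefl _ G) _ rich l20 lm.
  by rewrite card_ord.
have := prague_dim_le_cover pk cov; set d := prague_dim G => dle.
have ln : l <= n by lia.
have dl : d * l <= C.+1 * n.
  apply: leq_trans (leq_mul dle (leqnn l)) _; rewrite !mulSn leq_add //.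
  by apply: leq_trans sz _; rewrite leq_mul2l nlo orbT.
apply: leq_trans (leq_mul (leqnn d) ml) _.
have -> : d * (16 * j * l) = 16 * j * (d * l) by rewrite mulnCA.
by rewrite -[leqRHS]mulnA leq_mul2l dl orbT.
Qed.

(** * Expectations of products over pairs *)

Local Open Scope ring_scope.

Section Gnp.
Variables (R : realType) (n : nat).
Implicit Types (G : graph 'I_n) (E : {set {set 'I_n}}) (U : {set 'I_n}).

(** Expansion of a product of sums over all pairs, since a graph is a choice of one
term for each pair. *)
Lemma sum_graph_prod (x y : {set 'I_n} -> R) :
  \sum_(G : graph 'I_n) \prod_(e : {set 'I_n} | #|e| == 2%N)
     (if e \in edges G then x e else y e) =
  \prod_(e : {set 'I_n} | #|e| == 2%N) (x e + y e).
Proof.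
pose P (e : {set 'I_n}) := #|e| == 2%N.
pose a e := if P e then x e else 0; pose b e := if P e then y e else 1.
have -> : \prod_(e | P e) (x e + y e) = \prod_(e : {set 'I_n}) (a e + b e).
  rewrite big_mkcond; apply: eq_bigr => e _; rewrite /a /b.
  by case: ifP; rewrite ?add0r.
rewrite bigA_distr (bigID (fun E : {set {set 'I_n}} => [forall e in E, P e])) /=.
rewrite [X in _ = _ + X]big1 ?addr0; last first.
  move=> E /forall_inPn[e eE /negbTE Pe].
  by rewrite (bigD1 e)//= eE /a Pe mul0r.
rewrite [RHS](reindex_omap (@edges _) insub) /=; last first.
  by move=> E HE; case: insubP => [u _ /= ->//|]; rewrite HE.
apply: eq_big => [G|G _].
  by rewrite valK eqxx andbT; case: G => E HE; rewrite HE.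
rewrite big_mkcond; apply: eq_bigr => e _.
have Pedge : e \in edges G -> P e by case: G => E /= /forall_inP; apply.
rewrite /a /b.
by case: (boolP (e \in edges G)) => [/Pedge Pe|_]; rewrite ?Pe -?/(P e) ?Pe.
Qed.

Variables (p : R) (p01 : 0 <= p <= 1).

Lemma gnp_weight_ge0 G : 0 <= gnp_weight p G.
Proof.
have /andP[p0 p1] := p01.
by apply: prodr_ge0 => e _; case: ifP => _ //; rewrite subr_ge0.
Qed.

(** Markov's inequality for a product of independent factors, one for each pair
in E. *)
Lemma gnp_prob_moment (A : pred (graph 'I_n)) E (a b c : R) :
  {in E, forall e : {set 'I_n}, #|e| == 2%N} -> 0 <= a -> 0 <= b -> 0 <= c ->
  (forall G, A G ->
    1 <= c * \prod_(e in E) (if e \in edges G then a else b)) ->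
  gnp_prob p A <= c * (p * a + (1 - p) * b) ^+ #|E|.
Proof.
move=> E2 a0 b0 c0 hA.
pose x e := p * (if e \in E then a else 1).
pose y e := (1 - p) * (if e \in E then b else 1).
have wE G : gnp_weight p G * \prod_(e in E) (if e \in edges G then a else b) =
    \prod_(e : {set 'I_n} | #|e| == 2%N) (if e \in edges G then x e else y e).
  have -> : \prod_(e in E) (if e \in edges G then a else b) =
    \prod_(e : {set 'I_n} | #|e| == 2%N)
      (if e \in E then (if e \in edges G then a else b) else 1).
    rewrite -big_mkcondr /=; apply: eq_bigl => e.
    by case: (boolP (e \in E)) => [/E2->|]; rewrite ?andbF.
  rewrite /gnp_weight -big_split /=; apply: eq_bigr => e _.
  by rewrite /x /y; case: ifP; case: ifP.
have -> : (p * a + (1 - p) * b) ^+ #|E| =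
    \prod_(e : {set 'I_n} | #|e| == 2%N) (x e + y e).
  rewrite -prodr_const big_mkcond [RHS]big_mkcond; apply: eq_bigr => e _.
  rewrite /x /y; case: (boolP (e \in E)) => [/E2->//|_].
  by case: ifP; rewrite // !mulr1 addrC subrK.
rewrite -sum_graph_prod mulr_sumr /gnp_prob big_mkcond; apply: ler_sum => G _.
rewrite -wE mulrCA; have w0 := gnp_weight_ge0 G.
case: ifP => [/hA h|_]; first by rewrite ler_peMr.
rewrite !mulr_ge0 // prodr_ge0 // => e _; by case: ifP.
Qed.

Lemma gnp_probC (A : pred (graph 'I_n)) :
  gnp_prob p A = 1 - gnp_prob p (fun G => ~~ A G).
Proof.
rewrite -(gnp_prob_total n p) /gnp_prob [X in X - _](bigID A) /=.
by rewrite addrK.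
Qed.

Lemma gnp_prob_le (A B : pred (graph 'I_n)) :
  subpred A B -> gnp_prob p A <= gnp_prob p B.
Proof.
move=> AB; rewrite /gnp_prob big_mkcond [leRHS]big_mkcond; apply: ler_sum => G _.
case: ifP => [/AB->//|_]; by case: ifP => // _; apply: gnp_weight_ge0.
Qed.

Lemma gnp_prob_union (I : finType) (Q : pred I) (A : I -> pred (graph 'I_n)) :
  gnp_prob p (fun G => [exists i, Q i && A i G]) <= \sum_(i | Q i) gnp_prob p (A i).
Proof.
rewrite /gnp_prob.
under [leRHS]eq_bigr do rewrite big_mkcond.
rewrite exchange_big /= big_mkcond; apply: ler_sum => G _.
have w0 := gnp_weight_ge0 G.
have t0 i : 0 <= (if A i G then gnp_weight p G else 0) by case: ifP.
case: ifP => [/existsP[i /andP[Qi AiG]]|_]; last exact: sumr_ge0.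
by rewrite (bigD1 i) //= AiG lerDl sumr_ge0.
Qed.

Definition pairs U := [set e : {set 'I_n} | (e \subset U) && (#|e| == 2%N)].

Lemma card_pairs U : #|pairs U| = 'C(#|U|, 2).
Proof. exact: cards_draws. Qed.

Lemma clique_prob U :
  gnp_prob p (fun G => clique (non_adj G) U) <= (1 - p) ^+ 'C(#|U|, 2).
Proof.
rewrite -card_pairs.
have -> : 1 - p = p * 0 + (1 - p) * 1 by rewrite mulr0 add0r mulr1.
rewrite -[leRHS]mul1r; apply: gnp_prob_moment => //.
  by move=> e; rewrite inE => /andP[].
move=> G /cliqueP clq; rewrite mul1r big1 // => e.
rewrite inE => /andP[eU /cards2P[x [y [xy eE]]]].
suff -> : (e \in edges G) = false by [].
apply/negbTE; have [xU yU] : x \in U /\ y \in U.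
  by split; apply: (subsetP eU); rewrite eE !inE eqxx ?orbT.
by have /andP[_] := clq x y xU yU xy; rewrite /adj eE.
Qed.

Lemma sum_degrees_pairs G U :
  (\sum_(v in U) #|nbhd (non_adj G) v :&: U| =
   2 * #|[set e in pairs U | e \notin edges G]|)%N.
Proof.
set N := [set e in _ | _].
have N2 e : e \in N -> #|e| = 2%N by rewrite !inE => /andP[/andP[_ /eqP]].
transitivity (\sum_(v in U) \sum_(e in N) (v \in e : nat))%N.
  apply: eq_bigr => v vU.
  have -> : (\sum_(e in N) (v \in e : nat) = #|[set e in N | v \in e]|)%N.
    rewrite -sum1_card [RHS](eq_bigl (fun e => (e \in N) && (v \in e))).
      by rewrite big_mkcondr /=; apply: eq_bigr => e _; case: (v \in e).
    by move=> e; rewrite inE.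
  have -> : [set e in N | v \in e] =
      [set [set v; y] | y in nbhd (non_adj G) v :&: U].
    apply/setP => e; apply/idP/imsetP => [|[y]].
      rewrite inE => /andP[]; rewrite !inE => /andP[/andP[eU /cards2P[x [y [xy eE]]]] eG].
      have eU' z : z \in e -> z \in U := subsetP eU z.
      move: eG eU'; rewrite eE => eG eU'; rewrite !inE => /orP[/eqP|/eqP] vE.
        exists y; rewrite ?vE // !inE /non_adj xy eG /=.
        by apply: eU'; rewrite !inE eqxx orbT.
      exists x; rewrite ?vE 1?setUC // !inE /non_adj eq_sym xy /adj setUC eG /=.
      by apply: eU'; rewrite !inE eqxx.
    rewrite !inE => /andP[/andP[vy nvy] yU] ->.
    by rewrite cards2 vy !inE eqxx nvy subUset !sub1set vU yU.
  rewrite card_in_imset // => y z; rewrite !inE => /andP[/andP[vy _] _] _.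
  move=> /setP/(_ y); rewrite !inE eqxx orbT eq_sym (negPf vy) /=.
  by move=> /esym/eqP.
rewrite exchange_big /= (eq_bigr (fun=> 2%N)); first by rewrite sum_nat_const mulnC.
move=> e eN; rewrite -(N2 e eN) -[RHS]sum1_card big_mkcond [RHS]big_mkcond /=.
have /subsetP eU : e \subset U by move: eN; rewrite !inE => /andP[/andP[]].
apply: eq_bigr => v _; have := eU v; case: (v \in e) => [->//|_].
by case: ifP.
Qed.

(** A sparse set spans at most #|U|^2 / (8 j) non-edges of G, and the expectation of
2 to the power minus the number of non-edges is a power of (1 + p) / 2. *)
Lemma sparse_prob j U : (0 < j)%N -> (0 < #|U|)%N ->
  gnp_prob p (fun G => sparse (non_adj G) (4 * j) U) <=
  2 ^+ (#|U| ^ 2 %/ (8 * j)) * ((1 + p) / 2) ^+ 'C(#|U|, 2).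
Proof.
move=> j0 U0; set m := (_ %/ _)%N.
rewrite -card_pairs.
have -> : (1 + p) / 2 = p * 1 + (1 - p) * (1 / 2) by field.
apply: gnp_prob_moment; rewrite ?divr_ge0 ?exprn_ge0 //.
  by move=> e; rewrite inE => /andP[].
move=> G /forall_inP spU.
pose N := [set e in pairs U | e \notin edges G].
have -> : \prod_(e in pairs U) (if e \in edges G then 1 else 1 / 2 : R) =
    (1 / 2) ^+ #|N|.
  rewrite -prodr_const.
  rewrite [RHS](eq_bigl (fun e => (e \in pairs U) && (e \notin edges G))).
    by rewrite [RHS]big_mkcondr /=; apply: eq_bigr => e _; case: (_ \in _).
  by move=> e; rewrite !inE.
have Nm : (#|N| <= m)%N.
  have := sum_degrees_pairs G U; rewrite -/N => sumE.
  have : (4 * j * (2 * #|N|) <= #|U| * #|U|)%N.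
    rewrite -sumE big_distrr /= -[leqRHS]sum_nat_const; apply: leq_sum => v vU.
    exact/ltnW/spU.
  rewrite /m leq_divRL ?muln_gt0 ?j0 // expnS expn1; lia.
rewrite -(subnK Nm) exprD -mulrA -exprMn.
have -> : 2 * (1 / 2) = 1 :> R by field.
by rewrite expr1n mulr1 exprn_ege1 // ler1n.
Qed.

End Gnp.

(** * Almost all graphs are typical *)

Section Typical.
Variables (R : realType) (n N j : nat) (p : R).
Hypotheses (p01 : 0 <= p <= 1) (nN : (n <= 2 ^ N)%N) (N0 : (0 < N)%N).
Hypotheses (j0 : (0 < j)%N) (pj : ((1 + p) / 2) ^+ j <= 1 / 2).
Hypothesis qj : (1 - p) ^+ j <= 1 / 2.
Let h : R := 1 / 2.

Let h_ge0 : 0 <= h. Proof. by rewrite divr_ge0. Qed.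
Let h_le1 : h <= 1. Proof. by rewrite /h; lra. Qed.
Let h2 k : 2 ^+ k * h ^+ k = 1 :> R.
Proof. by rewrite -exprMn (_ : 2 * h = 1) ?expr1n // /h; field. Qed.

(** There are at most n^u <= 2^(N u) sets of size u, so a bound of 2^(-3 N u) for each
leaves 2^(-2 N) for each of the n sizes. *)
Lemma sum_sets_by_size (Q : pred {set 'I_n}) (f : {set 'I_n} -> R) :
  (forall U, Q U -> (0 < #|U|)%N) ->
  (forall U, Q U -> f U <= h ^+ (3 * N * #|U|)) ->
  \sum_(U | Q U) f U <= h ^+ N.
Proof.
move=> Q0 fU.
apply: (@le_trans _ _
    (\sum_(U : {set 'I_n}) \sum_(u < n) (#|U| == u.+1)%:R * h ^+ (3 * N * u.+1))).
  rewrite big_mkcond; apply: ler_sum => U _.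
  have pos (u : 'I_n) : 0 <= (#|U| == u.+1)%:R * h ^+ (3 * N * u.+1).
    by rewrite mulr_ge0 ?exprn_ge0.
  case: ifP => [QU|_]; last exact: sumr_ge0.
  have Un : (#|U|.-1 < n)%N.
    by rewrite prednK ?Q0 //; apply: leq_trans (max_card _) _; rewrite card_ord.
  rewrite (bigD1 (Ordinal Un)) //= prednK ?Q0 // eqxx mul1r.
  by apply: le_trans (fU U QU) _; rewrite lerDl sumr_ge0.
rewrite exchange_big /=.
apply: (@le_trans _ _ (\sum_(u < n) h ^+ (2 * N))).
  apply: ler_sum => u _; rewrite -mulr_suml -natr_sum.
  have -> : (\sum_(U : {set 'I_n}) (#|U| == u.+1) = 'C(n, u.+1))%N.
    have := card_draws 'I_n u.+1; rewrite card_ord => <-.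
    rewrite -sum1_card [RHS]big_mkcond /=.
    by apply: eq_bigr => U _; rewrite inE; case: eqP.
  apply: (@le_trans _ _ (2 ^+ (N * u.+1) * h ^+ (3 * N * u.+1))).
    apply: ler_wpM2r; first exact: exprn_ge0.
    rewrite -natrX ler_nat; apply: leq_trans (leq_bin_exp _ _) _.
    by rewrite expnM leq_exp2r.
  have -> : (3 * N * u.+1 = N * u.+1 + 2 * N * u.+1)%N by lia.
  rewrite exprD mulrA h2 mul1r; apply: ler_wiXn2l => //.
  by rewrite leq_pmulr.
rewrite sumr_const card_ord -mulr_natl.
rewrite mulSn mul1n exprD mulrA -[leRHS]mul1r; apply: ler_wpM2r.
  exact: exprn_ge0.
rewrite -[leRHS](h2 N); apply: ler_wpM2r; first exact: exprn_ge0.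
by rewrite -natrX ler_nat.
Qed.

Lemma sparse_set_exponent (U : {set 'I_n}) : (24 * j * N <= #|U|)%N ->
  gnp_prob p (fun G => sparse (non_adj G) (4 * j) U) <= h ^+ (3 * N * #|U|).
Proof.
move=> kU; set u := #|U| in kU *.
have u0 : (0 < u)%N by apply: leq_trans kU; rewrite !muln_gt0 j0 N0.
apply: le_trans (sparse_prob p01 j0 u0) _; rewrite -/u; set m := (_ %/ _)%N.
have r0 : 0 <= (1 + p) / 2 by case/andP: p01 => ? ?; lra.
have r1 : (1 + p) / 2 <= 1 by case/andP: p01 => ? ?; lra.
have mle : (m * (8 * j) <= u * u)%N by rewrite /m mulnn; apply: leq_trunc_div.
have hC : (j * m + j * (3 * N * u) <= 'C(u, 2))%N.
  have u24 : (24 <= u)%N by apply: leq_trans kU; rewrite -mulnA leq_pmulr // muln_gt0 j0.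
  have h3 : (24 * j * N * u <= u * u)%N by rewrite leq_mul2r kU orbT.
  have E : ('C(u, 2) * 2 = u * (u - 1))%N.
    by rewrite bin2 subn1 muln2 halfK oddM /=; case: (u) u0 => //= v _; rewrite andNb subn0.
  by move: E; rewrite mulnBr muln1; nia.
apply: (@le_trans _ _ (2 ^+ m * ((1 + p) / 2) ^+ (j * m + j * (3 * N * u)))).
  by apply: ler_wpM2l; [exact: exprn_ge0 | apply: ler_wiXn2l].
rewrite exprD mulrA (exprM _ j m) (exprM _ j (3 * N * u)) -exprMn -[leRHS]mul1r.
have rj0 : 0 <= ((1 + p) / 2) ^+ j by rewrite exprn_ge0.
have r2j0 : 0 <= 2 * ((1 + p) / 2) ^+ j by rewrite mulr_ge0.
apply: ler_pM; try by rewrite exprn_ge0.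
  by apply: exprn_ile1 => //; move: pj; lra.
by apply: lerXn2r; rewrite ?nnegrE.
Qed.

Lemma clique_set_exponent (K : {set 'I_n}) : #|K| = (6 * j * N).+1 ->
  gnp_prob p (fun G => clique (non_adj G) K) <= h ^+ (3 * N * #|K|).
Proof.
move=> Kk; apply: le_trans (clique_prob p01 K) _; rewrite Kk bin2 /=.
have -> : (((6 * j * N).+1 * (6 * j * N))./2 = j * (3 * N * (6 * j * N).+1))%N.
  have -> : ((6 * j * N).+1 * (6 * j * N) = (j * (3 * N * (6 * j * N).+1)).*2)%N.
    by rewrite -muln2; nia.
  by rewrite doubleK.
rewrite exprM; apply: lerXn2r => //; rewrite nnegrE ?exprn_ge0 //.
by case/andP: p01 => ? ?; lra.
Qed.

Lemma typical_prob : 1 - 2 * h ^+ N <= gnp_prob p (@typical n j N).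
Proof.
rewrite gnp_probC lerD2l lerN2.
pose B1 (G : graph 'I_n) := [exists U : {set 'I_n},
  (24 * j * N <= #|U|)%N && sparse (non_adj G) (4 * j) U].
pose B2 (G : graph 'I_n) := [exists K : {set 'I_n},
  (#|K| == (6 * j * N).+1) && clique (non_adj G) K].
have hB1 : gnp_prob p B1 <= h ^+ N.
  apply: le_trans (gnp_prob_union p01 _ _) _; apply: sum_sets_by_size => U kU.
    by apply: leq_trans kU; rewrite !muln_gt0 j0 N0.
  exact: sparse_set_exponent.
have hB2 : gnp_prob p B2 <= h ^+ N.
  apply: le_trans (gnp_prob_union p01 _ _) _; apply: sum_sets_by_size => U /eqP kU.
    by rewrite kU.
  exact: clique_set_exponent.
rewrite mulr_natl mulr2n; apply: le_trans (lerD hB1 hB2).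
rewrite /gnp_prob big_mkcond [X in _ <= X + _]big_mkcond.
rewrite [X in _ <= _ + X]big_mkcond -big_split /=; apply: ler_sum => G _.
have w0 := gnp_weight_ge0 p01 G.
rewrite /typical -/(B1 G) -/(B2 G).
by case: (B1 G); case: (B2 G); rewrite /= ?add0r ?addr0 // lerDl.
Qed.
End Typical.

(** * The order of the Prague dimension *)

(** Bernoulli's inequality in the form r^k (1 + k (1 - r)) <= 1. *)
Lemma exp_below_half (R : realType) (r : R) : 0 <= r < 1 ->
  exists j, forall j', (j <= j')%N -> r ^+ j' <= 1 / 2.
Proof.
case/andP=> r0 r1; pose d := 1 - r; have d0 : 0 < d by rewrite subr_gt0.
have bern k : r ^+ k * (1 + k%:R * d) <= 1.
  elim: k => [|k IH]; first by rewrite expr0 mul0r addr0 mulr1.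
  apply: le_trans IH; rewrite exprSr -mulrA; apply: ler_wpM2l; first exact: exprn_ge0.
  rewrite -natr1 (_ : r = 1 - d); last by rewrite /d; ring.
  have d2 := sqr_ge0 d; have kd2 := mulr_ge0 (ler0n R k) d2.
  by move: d2 kd2; lra.
exists (Num.bound d^-1) => j' jj'.
have : 1 <= j'%:R * d.
  rewrite -ler_pdivrMr // mul1r; apply: le_trans (ltW (archi_boundP _)) _.
    by rewrite invr_ge0 ltW.
  by rewrite ler_nat.
have := bern j'; have : 0 <= r ^+ j' by exact: exprn_ge0.
set a := r ^+ j'; set b := _ * d => a0 h b1.
have : a * 2 <= a * (1 + b) by apply: ler_wpM2l => //; lra.
by lra.
Qed.

Local Open Scope classical_set_scope.

Theorem theorem1 (R : realType) (p : R) (p_gt0 : 0 < p) (p_lt1 : p < 1) :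
  exists c C : R, [/\ 0 < c, 0 < C &
    (fun n : nat => gnp_prob p (fun G : graph 'I_n =>
       c * (n%:R / ln n%:R) <= (prague_dim G)%:R <= C * (n%:R / ln n%:R)))
      @ \oo --> (1 : R)].
Proof.
have [j1 j1P] : exists j, forall j', (j <= j')%N -> ((1 + p) / 2) ^+ j' <= 1 / 2.
  by apply: exp_below_half; lra.
have [j2 j2P] : exists j, forall j', (j <= j')%N -> (1 - p) ^+ j' <= 1 / 2.
  by apply: exp_below_half; lra.
have [D bounds] := typical_bounds.
(* One exponent serves both the sparse sets and the cliques. *)
pose j := (maxn j1 j2).+1; have j_gt0 : (0 < j)%N by [].
have pj : ((1 + p) / 2) ^+ j <= 1 / 2 by apply/j1P/leqW/leq_maxl.
have qj : (1 - p) ^+ j <= 1 / 2 by apply/j2P/leqW/leq_maxr.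
have p01 : 0 <= p <= 1 by rewrite !ltW.
have ln2 : 0 < ln (2 : R) by rewrite ln_gt0 // ltr1n.
pose a : R := (192 * j ^ 2)%:R; pose b : R := (16 * j * D.+1)%:R.
have a_gt0 : 0 < a by rewrite ltr0n muln_gt0 expn_gt0.
have b_gt0 : 0 < b by rewrite ltr0n !muln_gt0.
exists (4 * ln 2 / a), (8 * ln 2 * b); split.
- by rewrite divr_gt0 // mulr_gt0.
- by rewrite !mulr_gt0.
(* As n < 2 ^ N, typical graphs have probability at least 1 - 2 / (n + 1). *)
have harm : (fun n : nat => 1 - 2 * harmonic n) @ \oo --> (1 : R).
  have := cvgB (cvg_cst (1 : R)) (cvgMl_tmp (a := 2 : R) (@cvg_harmonic R)).
  by rewrite mulr0 subr0; apply.
apply: (squeeze_cvgr (f := fun n => 1 - 2 * harmonic n) (h := fun=> 1)) => //;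
  last exact: cvg_cst.
near=> n; apply/andP; split; last first.
  by rewrite -(gnp_prob_total n p); apply: gnp_prob_le.
(* Up to constant factors, 2 ^ m is the fourth root of n. *)
pose m := (trunc_log 2 n %/ 4)%N; pose N := (4 * m + 4)%N.
have n_big : (2 ^ (640 * j) <= n)%N by near: n; exact: nbhs_infty_ge.
have n_gt0 : (0 < n)%N by apply: leq_trans n_big; rewrite expn_gt0.
have /andP[nlo nhi] := trunc_log_bounds (isT : 1 < 2)%N n_gt0.
have mlog : (4 * m <= trunc_log 2 n < N)%N.
  by rewrite /N /m; move: (trunc_log 2 n) => k; clear; apply/andP; split; lia.
have jm : (160 * j <= m)%N.
  have : (640 * j <= trunc_log 2 n)%N.
    exact: trunc_log_max.
  by rewrite /m; move: (trunc_log 2 n) => k; clear; lia.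
have {}nlo : (2 ^ (4 * m) <= n)%N.
  by apply: leq_trans nlo; rewrite leq_exp2l //; case/andP: mlog.
have {}nhi : (n < 2 ^ N)%N.
  by apply: leq_trans nhi _; rewrite leq_exp2l //; case/andP: mlog.
have m_gt0 : (0 < m)%N by apply: leq_trans jm; rewrite muln_gt0.
apply: (@le_trans _ _ (1 - 2 * (1 / 2) ^+ N)).
  rewrite lerD2l lerN2 ler_pM2l // /harmonic /= expr_div_n expr1n div1r.
  by rewrite lef_pV2 ?posrE ?exprn_gt0 ?ltr0n // -natrX ler_nat.
have N_gt0 : (0 < N)%N by rewrite /N addnS.
apply: le_trans (typical_prob p01 (ltnW nhi) N_gt0 j_gt0 pj qj) _.
apply: gnp_prob_le => // G /(bounds n m j G j_gt0 jm nlo (ltnW nhi))[lower upper].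
have n_gt0' : 0 < n%:R :> R by rewrite ltr0n.
have lnlo : (4 * m)%:R * ln 2 <= ln (n%:R : R).
  rewrite mulr_natl -lnXn // ler_ln ?posrE ?exprn_gt0 //.
  by rewrite -natrX ler_nat.
have lnhi : ln (n%:R : R) <= (8 * m)%:R * ln 2.
  rewrite mulr_natl -lnXn // ler_ln ?posrE ?exprn_gt0 //.
  rewrite -natrX ler_nat; apply: leq_trans (ltnW nhi) _.
  by rewrite leq_exp2l // /N; move: m_gt0; clear; lia.
have ln_n_gt0 : 0 < ln (n%:R : R).
  by apply: lt_le_trans lnlo; rewrite mulr_gt0 // ltr0n muln_gt0.
set d := prague_dim G in lower upper *.
have {}lower : n%:R <= a * m%:R * d%:R :> R by rewrite -!natrM ler_nat.
have {}upper : d%:R * m%:R <= b * n%:R :> R.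
  rewrite -!natrM ler_nat; apply: leq_trans upper _.
  by rewrite leq_mul2r leq_mul2l leqnSn !orbT.
rewrite !mulrA; apply/andP; split.
  rewrite ler_pdivrMr // mulrAC ler_pdivrMr //.
  apply: le_trans (_ : 4 * ln 2 * (a * m%:R * d%:R) <= _).
    by rewrite ler_pM2l // mulr_gt0.
  have -> : 4 * ln 2 * (a * m%:R * d%:R) = (d%:R * a) * ((4 * m)%:R * ln 2).
    by rewrite natrM; ring.
  rewrite [leRHS]mulrAC; apply: ler_wpM2l => //.
  by rewrite mulr_ge0 ?ler0n // ltW.
rewrite ler_pdivlMr //.
apply: (@le_trans _ _ (d%:R * ((8 * m)%:R * ln 2))).
  by apply: ler_wpM2l.
have -> : d%:R * ((8 * m)%:R * ln 2) = (8 * ln 2) * (d%:R * m%:R) :> R.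
  by rewrite (natrM _ 8 m); ring.
by rewrite -[leRHS]mulrA ler_pM2l // mulr_gt0.
Unshelve. all: by end_near.
Qed.
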